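(* Let $n\ge 3$ and $N_1,N_2\ge 0$ be integers. The algebra $AQ_{-N_1}^{N_2}(2n)$ is Koszul.
   Context: The algebra: consider the polynomial ring over $\mathbb{C}$ in variables $f^i[s],g_j[t]$, $1\le i,j\le n$, $-N_1\le s,t\le N_2$. Then $$AQ_{-N_1}^{N_2}(2n)=\mathbb{C}[f^i[s],g_j[t]]/(r[-2N_1],\dots,r[2N_2]),\qquad r[l]=\sum_{s+t=l}\sum_{i=1}^n f^i[s]g_i[t],$$ graded by the degree in the variables. It is a quadratic algebra. Koszul property: a graded algebra $A=\bigoplus_{k\ge 0}A_k$ over $\mathbb{C}$ is quadratic if $A_0=\mathbb{C}$, $W=A_1$ generates $A$, and all relations follow from quadratic ones, i.e. $A=T(W)/(R)$ with $R\subset W\otimes W$. The dual quadratic algebra is $A^!=T(W^* )/(R^\perp)$, with $R^\perp\subset W^*\otimes W^*$ the annihilator of $R$. If $A$ is commutative, $R^\perp$ is spanned by anticommutators (symmetric tensors), so $A^!=U(L)$ is the universal enveloping algebra of a graded Lie superalgebra $L=\bigoplus_{k\ge1}L_k$ (with $L_k$ of parity $k$ mod 2) generated by $L_1=W^*$; $L$ is called Koszul dual to $A$. A quadratic commutative algebra $A$ is called Koszul if the cohomology $H(L)$ of the Cartan–Chevalley (Chevalley–Eilenberg) cochain complex $C(L)$ of $L$ with trivial coefficients $\mathbb{C}$ is equal to $A$ (where $A_1=L_1^*$ is the space of cochains dual to $L_1$). This is equivalent to the other standard definitions of a Koszul algebra. *)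

(* Defs.v *)
Set Warnings "-notation-incompatible-prefix,-notation-overridden".
From HB Require Import structures.
From mathcomp Require Import all_boot all_order all_algebra.
From mathcomp Require Import finmap.
From mathcomp Require Import boolp reals.
From mathcomp Require Import complex.
From mathcomp Require Import monalg.
From mathcomp Require Import mpoly.

Set Implicit Arguments.
Unset Strict Implicit.
Unset Printing Implicit Defensive.
Import Order.TTheory GRing.Theory Num.Theory.
Local Open Scope ring_scope.

Definition ideal_gen (A : nzRingType) (S : A -> Prop) (p : A) : Prop :=
  exists s : seq (A * A * A),
    (forall t, t \in s -> S t.1.2) /\ p = \sum_(t <- s) t.1.1 * t.1.2 * t.2.

Definition subspace (F : numFieldType) (V : lmodType F) (P : V -> Prop) : Prop :=
  P 0 /\ forall (a : F) u v, P u -> P v -> P (a *: u + v).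

(* V is the (internal) direct sum of the subspaces G 0, G 1, ... *)
Definition graded (F : numFieldType) (V : lmodType F) (G : nat -> V -> Prop) : Prop :=
  [/\ forall k, subspace (G k),
      forall v, exists (n : nat) (c : nat -> V),
        (forall k, G k (c k)) /\ v = \sum_(k < n) c k
    & forall (n : nat) (c : nat -> V), (forall k, G k (c k)) ->
        \sum_(k < n) c k = 0 -> forall k, (k < n)%N -> c k = 0].

Definition is_basis (F : numFieldType) (V : lmodType F) (P : V -> Prop)
    (m : nat) (x : 'I_m -> V) : Prop :=
  (forall v, P v <-> exists c : 'I_m -> F, v = \sum_i c i *: x i) /\
  (forall c : 'I_m -> F, \sum_i c i *: x i = 0 -> forall i, c i = 0).

Definition graded_algebra (F : numFieldType) (A : algType F) (G : nat -> A -> Prop) : Prop :=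
  [/\ graded G, G 0%N 1
    & forall i j a b, G i a -> G j b -> G (i + j)%N (a * b)].

(* The tensor algebra T(W) of the space W with basis 'I_m: the algebra of the
   free monoid of words in 'I_m. *)
Notation tensor_alg F m := {malg F[{fmonom 'I_m}]}.

Section Presentations.
Variables (F : numFieldType) (m : nat).

Definition quad_tensor (c : 'M[F]_m) : tensor_alg F m :=
  \sum_i \sum_j c i j *: (<< fmu i >> * << fmu j >>).

Definition tensor_eval (B : algType F) (x : 'I_m -> B) (t : tensor_alg F m) : B :=
  monalg.mmap (in_alg B) (fun w : {fmonom 'I_m} => \prod_(i <- w) x i) t.

(* B = T(W)/(rel), the basis of W being sent to x. *)
Definition presents (B : algType F) (x : 'I_m -> B) (rel : tensor_alg F m -> Prop) : Prop :=
  (forall b, exists t, b = tensor_eval x t) /\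
  (forall t, tensor_eval x t = 0 <-> ideal_gen rel t).

(* The space R of quadratic relations, as coefficient matrices. *)
Definition quad_rel (A : algType F) (x : 'I_m -> A) (r : 'M[F]_m) : Prop :=
  \sum_i \sum_j r i j *: (x i * x j) = 0.

(* The annihilator of R, in coordinates with respect to the dual basis of W^*. *)
Definition quad_rel_perp (A : algType F) (x : 'I_m -> A) (c : 'M[F]_m) : Prop :=
  forall r, quad_rel x r -> \sum_i \sum_j c i j * r i j = 0.

Definition quadratic_algebra (A : algType F) (G : nat -> A -> Prop) (x : 'I_m -> A) : Prop :=
  [/\ graded_algebra G,
      forall a, G 0%N a <-> exists c : F, a = c%:A,
      is_basis (G 1%N) x
    & presents x (fun t => exists2 r, quad_rel x r & t = quad_tensor r)].

(* B = A^!, and xi is the basis of W^* dual to the basis x of W = A_1. *)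
Definition quadratic_dual (A : algType F) (x : 'I_m -> A)
    (B : algType F) (xi : 'I_m -> B) : Prop :=
  presents xi (fun t => exists2 c, quad_rel_perp x c & t = quad_tensor c).

End Presentations.

(* Graded Lie superalgebras L = L_1 + L_2 + ..., with L_k of parity k mod 2.
   In characteristic 0 the identity [x,[x,x]] = 0 for odd x follows from the
   Jacobi identity. *)
Record lie_superalgebra (F : numFieldType) := LieSuperalgebra {
  lie_sort :> lmodType F;
  lie_hom : nat -> lie_sort -> Prop;
  lie_br : lie_sort -> lie_sort -> lie_sort;
  lie_graded : graded lie_hom;
  lie_hom0 : forall u, lie_hom 0%N u -> u = 0;
  lie_brDl : forall (a : F) u v w, lie_br (a *: u + v) w = a *: lie_br u w + lie_br v w;
  lie_brDr : forall (a : F) u v w, lie_br w (a *: u + v) = a *: lie_br w u + lie_br w v;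
  lie_br_hom : forall i j u v, lie_hom i u -> lie_hom j v -> lie_hom (i + j)%N (lie_br u v);
  lie_antisym : forall i j u v, lie_hom i u -> lie_hom j v ->
    lie_br u v = - ((-1) ^+ (i * j)%N *: lie_br v u);
  lie_jacobi : forall i j u v w, lie_hom i u -> lie_hom j v ->
    lie_br u (lie_br v w) =
      lie_br (lie_br u v) w + (-1) ^+ (i * j)%N *: lie_br v (lie_br u w)
}.

Section KoszulDual.
Variables (F : numFieldType) (L : lie_superalgebra F).

Definition lie_generated_by (P : L -> Prop) : Prop :=
  forall Q : L -> Prop, subspace Q -> (forall u v, Q u -> Q v -> Q (lie_br u v)) ->
    (forall u, P u -> Q u) -> forall u, Q u.

Definition lie_map_to_alg (B : algType F) (f : L -> B) : Prop :=
  (forall (a : F) u v, f (a *: u + v) = a *: f u + f v) /\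
  (forall i j u v, lie_hom i u -> lie_hom j v ->
     f (lie_br u v) = f u * f v - (-1) ^+ (i * j)%N *: (f v * f u)).

(* B, with the map iota, is the universal enveloping algebra U(L). *)
Definition enveloping_algebra (B : algType F) (iota : L -> B) : Prop :=
  lie_map_to_alg iota /\
  forall (B' : algType F) (f : L -> B'), lie_map_to_alg f ->
    exists g : {lrmorphism B -> B'}, (forall u, g (iota u) = f u) /\
      forall g' : {lrmorphism B -> B'}, (forall u, g' (iota u) = f u) -> g' =1 g.

(* L is Koszul dual to A, and e is the basis of L_1 = W^* dual to the basis x
   of W = A_1. *)
Definition koszul_dual (m : nat) (A : algType F) (x : 'I_m -> A) (e : 'I_m -> L) : Prop :=
  [/\ is_basis (lie_hom (l := L) 1%N) e,
      lie_generated_by (lie_hom (l := L) 1%N)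
    & exists (B : algType F) (iota : L -> B),
        enveloping_algebra iota /\ quadratic_dual x (fun i => iota (e i))].

End KoszulDual.

(* The Chevalley-Eilenberg complex C(L) with trivial coefficients.  A p-cochain
   is a p-linear form on L which is alternating in the super sense; it is encoded
   as a function on lists supported on the lists of size p, so that an element
   of C(L), the direct sum of the C^p(L), is a function on all lists vanishing on
   long ones.  Signs make sense on homogeneous arguments, which determine a
   multilinear form.  All forms are allowed, not only those of finite internal
   degree: this does not affect the question whether H^p(L) = A_p. *)
Section ChevalleyEilenberg.
Variables (F : numFieldType) (L : lie_superalgebra F).

Definition cochain (om : seq L -> F) : Prop :=
  [/\ forall s1 s2 (a : F) u v,
        om (s1 ++ (a *: u + v) :: s2) = a * om (s1 ++ u :: s2) + om (s1 ++ v :: s2),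
      forall s1 s2 i j u v, lie_hom i u -> lie_hom j v ->
        om (s1 ++ u :: v :: s2) = - ((-1) ^+ (i * j)%N * om (s1 ++ v :: u :: s2))
    & exists n, forall s, (n < size s)%N -> om s = 0].

Definition homogeneous (ks : seq nat) (s : seq L) : Prop :=
  size ks = size s /\ forall i, (i < size s)%N -> lie_hom (nth 0%N ks i) s`_i.

(* The value at s_0, ..., s_p, of degrees ks, of the differential of om: the sum over i < j of
   (-1)^(i+j) * (Koszul sign of moving s_i and s_j to the front)
     * om ([s_i, s_j], s_0, .., s_i omitted, .., s_j omitted, .., s_p). *)
Definition CE_diff (om : seq L -> F) (ks : seq nat) (s : seq L) : F :=
  \sum_(j < size s) \sum_(i < j)
    (-1) ^+ (i + j + nth 0 ks i * sumn (take i ks)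
             + nth 0 ks j * (sumn (take j ks) + nth 0 ks i))%N *
    om (lie_br s`_i s`_j :: take i s ++ drop i.+1 (take j s) ++ drop j.+1 s).

Definition cocycle (om : seq L -> F) : Prop :=
  cochain om /\ forall ks s, homogeneous ks s -> CE_diff om ks s = 0.

Definition coboundary (om : seq L -> F) : Prop :=
  exists eta, cochain eta /\ forall ks s, homogeneous ks s -> om s = CE_diff eta ks s.

Definition cohomologous (om om' : seq L -> F) : Prop :=
  coboundary (fun s => om s - om' s).

(* eps is the basis of L_1^* dual to e, extended by zero to the other L_k. *)
Definition dual_forms (m : nat) (e : 'I_m -> L) (eps : 'I_m -> L -> F) : Prop :=
  [/\ forall i (a : F) u v, eps i (a *: u + v) = a * eps i u + eps i v,
      forall i j, eps i (e j) = (i == j)%:R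
    & forall i k u, lie_hom k u -> k <> 1%N -> eps i u = 0].

(* The product in C(L) of the 1-cochains eps_i, i in w.  They are supported on
   the odd space L_1, so that all the signs cancel and the product is
   (s_1, .., s_p) |-> \sum_sigma \prod_a eps_(w_a) (s_(sigma a)). *)
Fixpoint cup_forms (m : nat) (eps : 'I_m -> L -> F) (w : seq 'I_m) (s : seq L) : F :=
  if w is i :: w' then
    \sum_(j < size s) eps i s`_j * cup_forms eps w' (take j s ++ drop j.+1 s)
  else (s == [::])%:R.

(* H(L) = A: a |-> class of Phi a is an isomorphism of algebras from A onto the
   cohomology of C(L), identical on A_1 = L_1^*.  As the x_i generate A,
   multiplicativity amounts to sending the product of any generators to the
   product of the corresponding 1-cochains. *)
Definition cohomology_is (m : nat) (A : algType F) (x : 'I_m -> A) (e : 'I_m -> L) : Prop :=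
  exists (eps : 'I_m -> L -> F) (Phi : A -> seq L -> F),
    [/\ dual_forms e eps,
        forall a, cocycle (Phi a),
        forall (c : F) a b,
          cohomologous (Phi (c *: a + b)) (fun s => c * Phi a s + Phi b s),
        forall w : seq 'I_m, cohomologous (Phi (\prod_(i <- w) x i)) (cup_forms eps w)
      & (forall a, coboundary (Phi a) -> a = 0) /\
        (forall om, cocycle om -> exists a, cohomologous om (Phi a))].

End ChevalleyEilenberg.

Definition koszul (F : numFieldType) (A : comAlgType F) (G : nat -> A -> Prop) : Prop :=
  exists (m : nat) (x : 'I_m -> A),
    quadratic_algebra G x /\
    exists (L : lie_superalgebra F) (e : 'I_m -> L),
      koszul_dual x e /\ cohomology_is x e.

Section AQ.
Variables (F : numFieldType) (n N1 N2 : nat).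

(* k : 'I_(N1 + N2).+1 stands for the index k - N1 in {-N1, ..., N2};
   (false, i, k) is the variable f^i[k - N1] and (true, i, k) is g_i[k - N1]. *)
Definition AQ_index (k : 'I_(N1 + N2).+1) : int := k%:Z - N1%:Z.
Definition AQ_var : finType := (bool * 'I_n * 'I_(N1 + N2).+1)%type.
Definition AQ_poly := {mpoly F[#|AQ_var|]}.

Definition AQ_f (i : 'I_n) (k : 'I_(N1 + N2).+1) : AQ_poly :=
  'X_(enum_rank ((false, i, k) : AQ_var)).
Definition AQ_g (i : 'I_n) (k : 'I_(N1 + N2).+1) : AQ_poly :=
  'X_(enum_rank ((true, i, k) : AQ_var)).

Definition AQ_r (l : int) : AQ_poly :=
  \sum_(s < (N1 + N2).+1) \sum_(t < (N1 + N2).+1 | AQ_index s + AQ_index t == l)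
    \sum_(i < n) AQ_f i s * AQ_g i t.

Definition AQ_relation (p : AQ_poly) : Prop :=
  exists l : int, - (2 * N1)%N%:Z <= l <= (2 * N2)%N%:Z /\ p = AQ_r l.

Definition AQ_ideal (p : AQ_poly) : bool := `[< ideal_gen AQ_relation p >].

Lemma AQ_ideal_closed : idealr_closed AQ_ideal.
Proof.
split.
- by apply/asboolP; exists [::]; split=> //; rewrite big_nil.
- apply/negP => /asboolP [s [hs]].
  move=> /(congr1 (fun p : AQ_poly => p.@[fun=> 0])).
  rewrite meval1 raddf_sum big_seq big1 => [/eqP|t /hs [l [_ tE]]].
    by rewrite oner_eq0.
  rewrite /= !mevalM tE.
  suff -> : (AQ_r l).@[fun=> 0] = 0 by rewrite mulr0 mul0r.
  rewrite raddf_sum big1 // => u _; rewrite raddf_sum big1 // => v _.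
  by rewrite raddf_sum big1 // => i _; rewrite /= mevalM !mevalXU mul0r.
- move=> a u v /asboolP [s [hs ->]] /asboolP [s' [hs' ->]]; apply/asboolP.
  exists ([seq (a * t.1.1, t.1.2, t.2) | t <- s] ++ s'); split.
    by move=> t; rewrite mem_cat => /orP[/mapP[t' /hs ? ->]|/hs'].
  rewrite big_cat big_map mulr_sumr; congr (_ + _).
  by apply: eq_bigr => t _; rewrite !mulrA.
Qed.

Definition AQ_idealr : idealr AQ_poly :=
  HB.pack AQ_ideal
    (GRing.isZmodClosed.Build _ AQ_ideal (idealr_closedB AQ_ideal_closed))
    (isProperIdeal.Build _ AQ_ideal (idealr_closed_nontrivial AQ_ideal_closed)).

Definition AQ := {ideal_quot AQ_idealr}.

HB.instance Definition _ := GRing.ComNzRing.on AQ.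

Definition AQ_pi : {rmorphism AQ_poly -> AQ} := \pi_({ideal_quot AQ_idealr})%qT.

Definition AQ_scale (c : F) (a : AQ) : AQ := AQ_pi c%:MP * a.

Lemma AQ_scaleA c d a : AQ_scale c (AQ_scale d a) = AQ_scale (c * d) a.
Proof. by rewrite /AQ_scale mulrA -!rmorphM. Qed.

Lemma AQ_scale1 : left_id 1 AQ_scale.
Proof. by move=> a; rewrite /AQ_scale !rmorph1 mul1r. Qed.

Lemma AQ_scaleDr : right_distributive AQ_scale +%R.
Proof. by move=> c a b; rewrite /AQ_scale mulrDr. Qed.

Lemma AQ_scaleDl a : {morph AQ_scale^~ a : c d / c + d}.
Proof. by move=> c d; rewrite /AQ_scale !rmorphD mulrDl. Qed.

HB.instance Definition _ := GRing.Zmodule_isLmodule.Build F AQ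
  AQ_scaleA AQ_scale1 AQ_scaleDr AQ_scaleDl.

Lemma AQ_scaleAl (c : F) (a b : AQ) : c *: (a * b) = (c *: a) * b.
Proof. exact: mulrA. Qed.

HB.instance Definition _ := GRing.Lmodule_isLalgebra.Build F AQ AQ_scaleAl.
HB.instance Definition _ := GRing.Lalgebra_isComAlgebra.Build F AQ.

Definition AQ_homog (k : nat) (a : AQ) : Prop :=
  exists2 p : AQ_poly, p \is k.-homog & a = AQ_pi p.

End AQ.

(* Main.v *)
(* Write r_1, ..., r_k for the defining quadrics.  In r[l] single out the monomial
   f^1[l/2] g_1[l/2] for l even and f^2[(l-1)/2] g_2[(l+1)/2] for l odd (indices shifted to
   start at 0).  These monomials have pairwise disjoint variables, and a quadratic weight on
   the indices makes each of them the unique heaviest monomial of its quadric.  The Koszul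
   complex of the leading monomials a_l b_l has an explicit homotopy, the sum over l of
   (d/da_l)(d/db_l) followed by exterior multiplication, whose Laplacian is diagonal on
   monomials and invertible in positive exterior degree; descending along the weight, the
   Koszul complex of the r_l is exact there as well, so the r_l form a complete intersection.

   Let L = L_1 + L_2 with [u, v] given on L_1 by the polarised quadrics and L_2 central.
   Then C(L) is the Koszul complex of the r_l, polynomials acting as symmetric forms by
   successive differentiation, so that H(L) = A.  In A^! the anticommutators of the
   generators span the dual of the space of quadrics; the element dual to r[l] is the
   anticommutator of the duals of f^i[s] and g_i[t], s + t = l, for any i, so that choosing i
   suitably shows that it commutes with any given generator.  Hence A^! = U(L). *)
From HB Require Import structures.
Require Import Defs.
From mathcomp Require Import all_boot all_order all_algebra.
From mathcomp Require Import generic_quotient ring_quotient.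
From mathcomp Require Import boolp reals.
From mathcomp Require Import complex.
From mathcomp Require Import monalg.
From mathcomp Require Import mpoly.
From mathcomp Require Import zify ring.

Set Implicit Arguments.
Unset Strict Implicit.
Unset Printing Implicit Defensive.
Import Order.TTheory GRing.Theory Num.Theory.
Local Open Scope ring_scope.

(** * Algebras presented by generators and relations *)

(** Disjoint leading variables force two values of i. With N = N1 + N2 there are 2N + 1 quadrics,
    hence 4N + 2 leading variables, while a single i provides only 2N + 2, too few as soon as N > 0.
    Even l therefore use one value of i and odd l another. The weights for the second value are the
    parabola of the first shifted by half a step, so that the parity of l decides which of the two
    reaches the top. Cochains are functions on lists, whereas exactness is proved for families of
    polynomials indexed by exterior monomials. The bridge is [cform]: contract with the arguments
    one by one and take the constant term. Coefficients are recovered by differentiation, every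
    cochain is reached by Euler's formula for homogeneous functions, and the two differentials agree
    because they satisfy the same recursion on the first argument. Characteristic 0 enters in this
    bridge and in dividing by the eigenvalues of the Laplacian. *)

Section TensorEval.
Variables (F : numFieldType) (m : nat) (B : algType F) (x : 'I_m -> B).

Definition word_eval (w : {fmonom 'I_m}) : B := \prod_(i <- (w : seq 'I_m)) x i.

Lemma word_eval_mmorphism : mmorphism word_eval.
Proof.
split=> [w w'|]; rewrite /word_eval; last by rewrite fm1 big_nil.
by rewrite fmM big_cat.
Qed.

HB.instance Definition _ :=
  monalg.isMultiplicative.Build {fmonom 'I_m} B word_eval word_eval_mmorphism.

Lemma tensor_evalE t : tensor_eval x t = monalg.mmap (in_alg B) word_eval t.
Proof. by []. Qed.

Lemma tensor_eval_linear : linear (tensor_eval x).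
Proof.
move=> c t t'; rewrite !tensor_evalE raddfD /= (@monalg.mmapZ _ _ _ (in_alg B)) /=.
by rewrite mulr_algl.
Qed.

HB.instance Definition _ :=
  GRing.isLinear.Build F (tensor_alg F m) B _ (tensor_eval x) tensor_eval_linear.

Lemma tensor_eval_monoid : monoid_morphism (tensor_eval x).
Proof.
have h (g : tensor_alg F m) w w' :
    GRing.comm ((in_alg B) (monalg.mcoeff w g)) (word_eval w').
  by rewrite /GRing.comm /= mulr_algl mulr_algr.
by have [hM h1] := monalg.commr_mmap_is_multiplicative h; split.
Qed.

HB.instance Definition _ :=
  GRing.isMonoidMorphism.Build (tensor_alg F m) B (tensor_eval x)
    tensor_eval_monoid.

Lemma tensor_evalU i : tensor_eval x << fmu i >> = x i.
Proof.
by rewrite tensor_evalE (@monalg.mmapU _ _ _ (in_alg B)) /= /word_eval fmU big_seq1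
  scale1r mul1r.
Qed.

Lemma tensor_eval_quad c :
  tensor_eval x (quad_tensor c) = \sum_i \sum_j c i j *: (x i * x j).
Proof.
rewrite /quad_tensor linear_sum; apply: eq_bigr => i _.
rewrite linear_sum; apply: eq_bigr => j _ /=.
by rewrite linearZ rmorphM /= !tensor_evalU.
Qed.
End TensorEval.

Lemma tensor_monoZ (F : numFieldType) m (c : F) (w : {fmonom 'I_m}) :
  << c *g w >> = c *: << w >> :> tensor_alg F m.
Proof.
apply/malgP => k; rewrite monalg.mcoeffZ !mcoeffU.
by case: eqP => _; rewrite /= ?mulr1 ?mulr0.
Qed.

Lemma tensor_ind (F : numFieldType) m (P : tensor_alg F m -> Prop) :
  P 1 -> (forall a t t', P t -> P t' -> P (a *: t + t')) ->
  (forall i t, P t -> P (<< fmu i >> * t)) -> forall t, P t.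
Proof.
move=> P1 PD PM t.
have P0 : P 0 by have := PD (-1) 1 1 P1 P1; rewrite scaleN1r addNr.
rewrite [t]monalgE; elim/big_rec: _ => // w t' _ Pt'.
have -> : << monalg.mcoeff w t *g w >> = monalg.mcoeff w t *: << w >> :> tensor_alg F m.
  exact: tensor_monoZ.
apply: PD => //; rewrite -[w]fmK; elim: (w : seq _) => [|i s IHs].
  by rewrite -fmoneE.
suff -> : << FMonom (i :: s) >> = << fmu i >> * << FMonom s >> :> tensor_alg F m by exact: PM.
rewrite malgM_def fgmulUU mulr1; congr << _ *g _ >>.
by apply: val_inj; rewrite /= fmM fmU.
Qed.

Lemma lrmorph_tensor_eval (F : numFieldType) m (B B' : algType F)
    (x : 'I_m -> B) (g : {lrmorphism B -> B'}) t :
  g (tensor_eval x t) = tensor_eval (g \o x) t.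
Proof.
elim/tensor_ind: t => [|a t t' h h'|i t h]; first by rewrite !rmorph1.
  by rewrite !linearP /= h h'.
by rewrite !rmorphM /= h !tensor_evalU.
Qed.

Section TwoSidedQuotient.
Variables (F : numFieldType) (A : lalgType F) (P : A -> Prop).
Hypothesis A_scaleAr : forall (c : F) (a b : A), c *: (a * b) = a * (c *: b).
Hypotheses (P0 : P 0) (PD : forall a b, P a -> P b -> P (a + b)).
Hypotheses (PMl : forall a b, P b -> P (a * b)) (PMr : forall a b, P a -> P (a * b)).
Hypothesis (P1 : ~ P 1).

(** The operations are computed on representatives, and [~ P 1] makes the quotient a nonzero ring.
    Compatibility of scalars with the right factor is a hypothesis because the intended [A] is the
    free algebra, for which [tensor_scaleAr] proves it. *)
Lemma two_sided_quotient :
  exists (Q : algType F) (p : {lrmorphism A -> Q}),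
    (forall b, exists a, b = p a) /\ (forall a, p a = 0 <-> P a).
Proof.
pose I : pred A := fun a => `[< P a >].
have IN : oppr_closed I.
  by move=> a /asboolP Pa; apply/asboolP; rewrite -mulN1r; apply: PMl.
have IB : zmod_closed I.
  split; first exact/asboolP.
  move=> a b /asboolP Pa /asboolP Pb; apply/asboolP; apply: PD => //.
  by apply/asboolP/IN/asboolP.
pose zI : zmodClosed A := HB.pack I (GRing.isZmodClosed.Build _ I IB).
pose Q0 := Quotient.quot zI.
pose pi : A -> Q0 := \pi_(Q0)%qT.
have piE a b : pi a = pi b <-> P (a - b).
  split=> [/eqP|h]; last by apply/eqP; rewrite -Quotient.idealrBE; apply/asboolP.
  by rewrite -Quotient.idealrBE => /asboolP.
have piK a : pi (repr a) = a by exact: reprK.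
have piR a : P (repr (pi a) - a) by apply/piE/piK.
pose mul (a b : Q0) := pi (repr a * repr b).
have mulE a b : mul (pi a) (pi b) = pi (a * b).
  apply/piE; rewrite (_ : _ - _ = (repr (pi a) - a) * repr (pi b) + a * (repr (pi b) - b)).
    by apply: PD; [apply: PMr|apply: PMl].
  by rewrite mulrBl mulrBr addrA subrK.
have surj (P' : Q0 -> Prop) : (forall a, P' (pi a)) -> forall b, P' b.
  by move=> h b; rewrite -(piK b).
have piB a b : pi (a - b) = pi a - pi b by exact: raddfB.
have piD a b : pi (a + b) = pi a + pi b by exact: raddfD.
have pi0 : pi 0 = 0 by exact: raddf0.
have mA : associative mul.
  by elim/surj=> a; elim/surj=> b; elim/surj=> c; rewrite !mulE mulrA.
have m1l : left_id (pi 1) mul by elim/surj=> a; rewrite mulE mul1r.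
have m1r : right_id (pi 1) mul by elim/surj=> a; rewrite mulE mulr1.
have mDl : left_distributive mul +%R.
  by elim/surj=> a; elim/surj=> b; elim/surj=> c; rewrite -piD !mulE mulrDl piD.
have mDr : right_distributive mul +%R.
  by elim/surj=> a; elim/surj=> b; elim/surj=> c; rewrite -piD !mulE mulrDr piD.
have n01 : pi 1 != 0.
  by apply/eqP; rewrite -pi0 => /piE; rewrite subr0.
pose Q1 : nzRingType := HB.pack Q0
  (GRing.Zmodule_isNzRing.Build Q0 mA m1l m1r mDl mDr n01).
pose sc (c : F) (a : Q0) : Q0 := pi (c *: repr a).
have scE c a : sc c (pi a) = pi (c *: a).
  apply/piE; rewrite -scalerBr -[_ - a]mul1r scalerAl; exact: PMl.
have sA c d a : sc c (sc d a) = sc (c * d) a.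
  by elim/surj: a => a; rewrite !scE scalerA.
have s1 : left_id 1 sc by elim/surj=> a; rewrite scE scale1r.
have sDr : right_distributive sc +%R.
  by move=> c; elim/surj=> a; elim/surj=> b; rewrite -piD !scE scalerDr piD.
have sDl a : {morph sc^~ a : c d / c + d}.
  by move=> c d; elim/surj: a => a; rewrite !scE scalerDl piD.
pose Q2 : lmodType F := HB.pack Q1
  (GRing.Zmodule_isLmodule.Build F Q1 sA s1 sDr sDl).
have sAl (c : F) (a b : Q0) : sc c (mul a b) = mul (sc c a) b.
  by elim/surj: a => a; elim/surj: b => b; rewrite mulE !scE mulE scalerAl.
have sAr (c : F) (a b : Q0) : sc c (mul a b) = mul a (sc c b).
  by elim/surj: a => a; elim/surj: b => b; rewrite mulE !scE mulE A_scaleAr.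
pose Q3 : lalgType F := HB.pack Q1 Q2
  (GRing.Lmodule_isLalgebra.Build F Q2 sAl).
pose Q : algType F := HB.pack Q1 Q2 Q3
  (GRing.Lalgebra_isAlgebra.Build F Q3 sAr).
have pl : linear (pi : A -> Q) by move=> c a b; rewrite piD -scE.
have pm : monoid_morphism (pi : A -> Q) by split=> // a b; rewrite -mulE.
pose p : {lrmorphism A -> Q} := HB.pack (pi : A -> Q)
  (GRing.isLinear.Build _ _ _ _ (pi : A -> Q) pl)
  (GRing.isMonoidMorphism.Build _ _ (pi : A -> Q) pm).
exists Q, p; split=> [b|a]; first by exists (repr b : A); rewrite -[LHS]piK.
rewrite -[p a]/(pi a) -[0]pi0; split=> [/piE|h]; first by rewrite subr0.
by apply/piE; rewrite subr0.
Qed.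
End TwoSidedQuotient.

Section IdealGen.
Variables (A : nzRingType) (S : A -> Prop).

Lemma ideal_gen0 : ideal_gen S 0.
Proof. by exists [::]; rewrite big_nil. Qed.

Lemma ideal_genD a b : ideal_gen S a -> ideal_gen S b -> ideal_gen S (a + b).
Proof.
move=> [s [hs ->]] [s' [hs' ->]]; exists (s ++ s'); split; last by rewrite big_cat.
by move=> t; rewrite mem_cat => /orP[/hs|/hs'].
Qed.

Lemma ideal_genMl a b : ideal_gen S b -> ideal_gen S (a * b).
Proof.
move=> [s [hs ->]]; exists [seq (a * t.1.1, t.1.2, t.2) | t <- s]; split.
  by move=> t /mapP[t' /hs ? ->].
by rewrite big_map mulr_sumr; apply: eq_bigr => t _; rewrite !mulrA.
Qed.

Lemma ideal_genMr a b : ideal_gen S a -> ideal_gen S (a * b).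
Proof.
move=> [s [hs ->]]; exists [seq (t.1.1, t.1.2, t.2 * b) | t <- s]; split.
  by move=> t /mapP[t' /hs ? ->].
by rewrite big_map mulr_suml; apply: eq_bigr => t _; rewrite !mulrA.
Qed.

Lemma ideal_gen_base a : S a -> ideal_gen S a.
Proof.
move=> Sa; exists [:: (1, a, 1)]; split; first by move=> t; rewrite inE => /eqP ->.
by rewrite big_seq1 mul1r mulr1.
Qed.

Lemma ideal_gen_morph0 (B : nzRingType) (f : {rmorphism A -> B}) a :
  (forall b, S b -> f b = 0) -> ideal_gen S a -> f a = 0.
Proof.
move=> hf [s [hs ->]]; rewrite rmorph_sum big_seq big1 // => t /hs /hf h; rewrite /=.
by rewrite !rmorphM /= h mulr0 mul0r.
Qed.
End IdealGen.

Section Presentation.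
Variables (F : numFieldType) (m : nat).

Lemma tensor_scaleAr (c : F) (a b : tensor_alg F m) : c *: (a * b) = a * (c *: b).
Proof.
have mulC (g : tensor_alg F m) : g * << c *g (mone : {fmonom 'I_m}) >> = c *: g.
  rewrite {1}[g]monalgE mulr_suml [in RHS](monalgE g) scaler_sumr.
  apply: eq_bigr => w _; rewrite malgM_def fgmulUU mulm1.
  by rewrite tensor_monoZ [in RHS]tensor_monoZ scalerA mulrC.
by rewrite -(monalg.mul_malgC c b) mulrA mulC scalerAl.
Qed.

(** The hypothesis says that the augmentation, sending every generator to 0, kills the relations;
    hence 1 is not in their ideal and the quotient is a nonzero ring. *)
Lemma presentation_exists (rel : tensor_alg F m -> Prop) :
  (forall t, rel t -> tensor_eval (fun=> (0 : F^o)) t = 0) ->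
  exists (B : algType F) (x : 'I_m -> B), presents x rel.
Proof.
move=> hrel; have n1 : ~ ideal_gen rel 1.
  move/(ideal_gen_morph0 hrel); rewrite rmorph1; apply/eqP; exact: oner_neq0.
have [B [p [psurj pker]]] := two_sided_quotient tensor_scaleAr
  (ideal_gen0 rel) (@ideal_genD _ rel) (@ideal_genMl _ rel) (@ideal_genMr _ rel) n1.
exists B, (fun i => p << fmu i >>).
have pE t : tensor_eval (fun i => p << fmu i >>) t = p t.
  elim/tensor_ind: t => [|a t t' h h'|i t h]; first by rewrite !rmorph1.
    by rewrite !linearP /= h h'.
  by rewrite !rmorphM /= h !tensor_evalU.
split=> [b|t]; last by rewrite pE.
by have [t ->] := psurj b; exists t; rewrite pE.
Qed.

Lemma presents_lift (B B' : algType F) (x : 'I_m -> B) (y : 'I_m -> B')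
    (rel : tensor_alg F m -> Prop) :
  presents x rel -> (forall t, rel t -> tensor_eval y t = 0) ->
  exists g : {lrmorphism B -> B'}, forall i, g (x i) = y i.
Proof.
move=> [xsurj xker] hy.
have /choice [s sE] := xsurj.
pose g b := tensor_eval y (s b).
have gE t : g (tensor_eval x t) = tensor_eval y t.
  apply/eqP; rewrite -subr_eq0 -raddfB; apply/eqP.
  apply: (@ideal_gen_morph0 _ rel) => //; apply/xker.
  by rewrite raddfB /= -sE subrr.
have gl : linear g.
  by move=> c a b; rewrite [a]sE [b]sE -linearP !gE linearP.
have gm : monoid_morphism g.
  split; first by rewrite -(rmorph1 (tensor_eval x)) gE rmorph1.
  by move=> a b; rewrite [a]sE [b]sE -rmorphM !gE rmorphM.
pose g' : {lrmorphism B -> B'} := HB.pack g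
  (GRing.isLinear.Build _ _ _ _ g gl) (GRing.isMonoidMorphism.Build _ _ g gm).
by exists g' => i; rewrite -[g' _]/(g _) -(tensor_evalU x) gE tensor_evalU.
Qed.

Lemma presents_ext (B B' : algType F) (x : 'I_m -> B) (rel : tensor_alg F m -> Prop)
    (g g' : {lrmorphism B -> B'}) :
  presents x rel -> (forall i, g (x i) = g' (x i)) -> g =1 g'.
Proof.
move=> [xsurj _] h b; have [t ->] := xsurj b.
rewrite !lrmorph_tensor_eval; congr tensor_eval; exact/funext.
Qed.
End Presentation.

(** * Koszul complexes *)

Lemma sum_neq0 (V : zmodType) (T : finType) (f : T -> V) :
  \sum_i f i != 0 -> exists i, f i != 0.
Proof.
move=> h; apply/existsP; apply: contraR h => /existsPn h.
by rewrite big1 // => i _; apply/eqP; rewrite -[_ == _]negbK h.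
Qed.

Lemma mcoeff_sum (F : numFieldType) m (T : finType) (f : T -> mpoly.mpoly m F) al :
  (\sum_t f t)@_al = \sum_t (f t)@_al.
Proof. exact: raddf_sum. Qed.

Section KoszulComplex.
Variables (F : numFieldType) (m r : nat).

Local Notation S_ := (mpoly.mpoly m F).
(* [k] stands for the sum over [I] of [k I] times the exterior product, in increasing order,
   of the generators with index in [I]. *)
Local Notation superpoly := ({set 'I_r} -> S_).
Implicit Types (k : superpoly) (I : {set 'I_r}) (l : 'I_r) (p q : S_).

(** The sign of moving generator [l] to its place in the increasing product over [I]. The inequality
    is strict, so the value is the same whether or not [l] belongs to [I]. *)
Definition esign l I : F := \prod_(j in I) (-1) ^+ (j < l)%N.

Lemma esignU1 l l' I : l' \notin I -> esign l (l' |: I) = (-1) ^+ (l' < l)%N * esign l I.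
Proof. by move=> h; rewrite /esign big_setU1. Qed.

Lemma esign_sq l I : esign l I * esign l I = 1.
Proof.
rewrite /esign -big_split big1 //= => j _.
by rewrite -expr2 sqrr_sign.
Qed.

Lemma sign_ltn_swap l l' : l != l' -> (-1) ^+ (l < l')%N = - (-1) ^+ (l' < l)%N :> F.
Proof.
by rewrite -val_eqE /=; case: ltngtP => //= _ _; rewrite ?opprK.
Qed.

Definition contr l k : superpoly :=
  fun I => if l \in I then 0 else esign l I *: k (l |: I).
Definition wedge l k : superpoly :=
  fun I => if l \in I then esign l I *: k (I :\ l) else 0.

Lemma contr_linear l c k k' I :
  contr l (fun J => c *: k J + k' J) I = c *: contr l k I + contr l k' I.
Proof.
rewrite /contr; case: (l \in I); first by rewrite scaler0 addr0.
by rewrite scalerDr !scalerA mulrC.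
Qed.

Lemma contr_sum (T : finType) l (f : T -> superpoly) I :
  contr l (fun J => \sum_t f t J) I = \sum_t contr l (f t) I.
Proof.
by rewrite /contr; case: (l \in I); rewrite ?big1_eq // scaler_sumr.
Qed.

Lemma wedge_sum (T : finType) l (f : T -> superpoly) I :
  wedge l (fun J => \sum_t f t J) I = \sum_t wedge l (f t) I.
Proof.
by rewrite /wedge; case: (l \in I); rewrite ?big1_eq // scaler_sumr.
Qed.

Lemma contr_map (g : {linear S_ -> S_}) l k I :
  contr l (fun J => g (k J)) I = g (contr l k I).
Proof. by rewrite /contr; case: (l \in I); rewrite ?linear0 ?linearZ. Qed.

Lemma wedge_map (g : {linear S_ -> S_}) l k I :
  wedge l (fun J => g (k J)) I = g (wedge l k I).
Proof. by rewrite /wedge; case: (l \in I); rewrite ?linear0 ?linearZ. Qed.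

Lemma contr_mul p l k I : contr l (fun J => p * k J) I = p * contr l k I.
Proof. by rewrite /contr; case: (l \in I); rewrite ?mulr0 // -scalerAr. Qed.

Lemma wedge_mul p l k I : wedge l (fun J => p * k J) I = p * wedge l k I.
Proof. by rewrite /wedge; case: (l \in I); rewrite ?mulr0 // -scalerAr. Qed.

(** This and the next three lemmas are the Clifford relations: contractions anticommute, [contr l]
    and [wedge l'] anticommute for l != l', and [contr l] and [wedge l] have anticommutator the
    identity, one product living on the [I] without [l] and the other on the [I] with [l]. *)
Lemma contr_anticomm l l' k I : contr l (contr l' k) I = - contr l' (contr l k) I.
Proof.
rewrite /contr !in_setU1 [l' == l]eq_sym.
have [<-|nll'] := eqVneq l l'; first by case: (l \in I); rewrite ?scaler0 oppr0.
case: (boolP (l \in I)) => lI; case: (boolP (l' \in I)) => l'I;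
  rewrite ?scaler0 ?oppr0 //=.
rewrite !scalerA !esignU1 // (sign_ltn_swap nll') setUCA -scaleNr.
by congr (_ *: _); ring.
Qed.

Lemma contr_wedge_neq l l' k I : l != l' ->
  contr l (wedge l' k) I = - wedge l' (contr l k) I.
Proof.
move=> nll'; rewrite /contr /wedge in_setU1 in_setD1.
rewrite [l' == l]eq_sym (negPf nll') /=.
case: (boolP (l \in I)) => lI; case: (boolP (l' \in I)) => l'I;
  rewrite ?scaler0 ?oppr0 //=.
rewrite !scalerA !esignU1 //.
have -> : (l |: I) :\ l' = l |: (I :\ l').
  by apply/setP => j; rewrite !inE; case: (eqVneq j l) => [->|]; rewrite ?nll' ?orbT ?andbT.
have -> : esign l I = (-1) ^+ (l' < l)%N * esign l (I :\ l').
  by rewrite -esignU1 ?setD11 // setD1K.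
rewrite (sign_ltn_swap nll') -scaleNr; congr (_ *: _).
have := sqrr_sign F (l' < l)%N; set s := (-1) ^+ _ => hs.
by ring: hs.
Qed.

Lemma contr_wedge_eq l k I : contr l (wedge l k) I = if l \in I then 0 else k I.
Proof.
rewrite /contr /wedge setU11; case: (boolP (l \in I)) => // lI.
by rewrite setU1K // scalerA esignU1 // ltnn mul1r esign_sq scale1r.
Qed.

Lemma wedge_contr_eq l k I : wedge l (contr l k) I = if l \in I then k I else 0.
Proof.
rewrite /contr /wedge setD11; case: (boolP (l \in I)) => // lI.
have -> : esign l I = esign l (I :\ l).
  by rewrite -{1}(setD1K lI) esignU1 ?setD11 // ltnn mul1r.
by rewrite scalerA esign_sq scale1r setD1K.
Qed.

Definition koszul_d (Q : 'I_r -> S_) k : superpoly :=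
  fun I => \sum_l Q l * contr l k I.

Lemma koszul_dDl Q Q' k I :
  koszul_d (fun l => Q l + Q' l) k I = koszul_d Q k I + koszul_d Q' k I.
Proof. by rewrite -big_split; apply: eq_bigr => l _; rewrite mulrDl. Qed.

Lemma koszul_d_linear Q c k k' I :
  koszul_d Q (fun J => c *: k J + k' J) I = c *: koszul_d Q k I + koszul_d Q k' I.
Proof.
rewrite /koszul_d scaler_sumr -big_split; apply: eq_bigr => l _ /=.
by rewrite contr_linear mulrDr scalerAr.
Qed.

Lemma koszul_dB Q k k' I :
  koszul_d Q (fun J => k J - k' J) I = koszul_d Q k I - koszul_d Q k' I.
Proof.
have := koszul_d_linear Q (-1) k' k I; rewrite scaleN1r addrC => <-.
by congr koszul_d; apply/funext => J; rewrite scaleN1r addrC.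
Qed.

Lemma koszul_dD Q k k' I :
  koszul_d Q (fun J => k J + k' J) I = koszul_d Q k I + koszul_d Q k' I.
Proof.
have := koszul_d_linear Q 1 k k' I; rewrite scale1r => <-.
by congr koszul_d; apply/funext => J; rewrite scale1r.
Qed.

Lemma koszul_d0 Q I : koszul_d Q (fun=> 0) I = 0.
Proof.
by rewrite /koszul_d big1 // => l _; rewrite /contr; case: (l \in I); rewrite ?scaler0 mulr0.
Qed.

Lemma koszul_dd Q k I : koszul_d Q (koszul_d Q k) I = 0.
Proof.
pose S := \sum_l \sum_l' Q l * (Q l' * contr l (contr l' k) I).
have E : koszul_d Q (koszul_d Q k) I = S.
  apply: eq_bigr => l _; rewrite /koszul_d contr_sum mulr_sumr.
  by apply: eq_bigr => l' _; rewrite contr_mul.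
have : S = - S.
  rewrite {1}/S exchange_big /S -sumrN; apply: eq_bigr => l _.
  rewrite -sumrN; apply: eq_bigr => l' _; rewrite contr_anticomm !mulrN.
  by rewrite mulrCA.
rewrite E => /eqP; rewrite -addr_eq0 -mulr2n -scaler_nat scaler_eq0 pnatr_eq0 /=.
by move/eqP.
Qed.

Lemma mcoeffXM (M : 'X_{1..m}) p al :
  ('X_[M] * p)@_al = if (M <= al)%MM then p@_(al - M) else 0.
Proof.
case: (boolP (M <= al)%MM) => h; rewrite mulrC.
  by rewrite -{1}(submK h) addmC mcoeffMX.
apply: memN_msupp_eq0; rewrite (perm_mem (msuppMX p M)).
by apply: contra h => /mapP [b _ ->]; exact: lem_addr.
Qed.

Variables (a b : 'I_r -> 'I_m).
Hypothesis a_neq_b : forall l, a l != b l.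
Hypothesis ab_disj : forall l l', l != l' ->
  [/\ a l != a l', a l != b l', b l != a l' & b l != b l'].

Definition lead l : 'X_{1..m} := (U_(a l) + U_(b l))%MM.
Definition dlead l p := p^`M(a l)^`M(b l).

Lemma dlead_linear l : linear (dlead l).
Proof. by move=> c p q; rewrite /dlead !linearP. Qed.
HB.instance Definition _ l :=
  GRing.isLinear.Build F S_ S_ _ (dlead l) (dlead_linear l).

(* The operators [X_a X_b contr] and [D_a D_b wedge] are adjoint to each other, so that
   the homotopy below makes the Laplacian diagonal on monomials, with eigenvalues [lapl]. *)
Definition homot k : superpoly := fun I => \sum_l dlead l (wedge l k I).

Lemma leadE l i : lead l i = ((a l == i) + (b l == i))%N.
Proof. by rewrite mnmDE !mnm1E. Qed.

Lemma lead_aa l : lead l (a l) = 1%N.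
Proof. by rewrite leadE eqxx eq_sym (negPf (a_neq_b l)). Qed.
Lemma lead_bb l : lead l (b l) = 1%N.
Proof. by rewrite leadE eqxx (negPf (a_neq_b l)). Qed.
Lemma lead_a l l' : l != l' -> lead l (a l') = 0%N.
Proof. by move=> /ab_disj[/negPf h1 _ /negPf h2 _]; rewrite leadE h1 h2. Qed.
Lemma lead_b l l' : l != l' -> lead l (b l') = 0%N.
Proof. by move=> /ab_disj[_ /negPf h1 _ /negPf h2]; rewrite leadE h1 h2. Qed.

Lemma mcoeff_dlead l p al :
  (dlead l p)@_al = p@_(al + lead l) *+ ((al (a l)).+1 * (al (b l)).+1).
Proof.
rewrite /dlead !mcoeff_mderiv -mulrnA mnmDE mnm1E eq_sym (negPf (a_neq_b l)).
by rewrite addn0 -addmA [(U_(b l) + _)%MM]addmC.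
Qed.

(** Disjointness of the leading variables enters here. Together with [contr_wedge_neq] it cancels
    the off-diagonal terms of the Laplacian in [homot_laplace]. *)
Lemma dlead_mulX l l' p : l != l' ->
  dlead l' ('X_[lead l] * p) = 'X_[lead l] * dlead l' p.
Proof.
move=> h; have e := lead_a h; have e' := lead_b h.
by rewrite /dlead mderivM mderivX e scale0r mul0r add0r mderivM mderivX e' scale0r mul0r add0r.
Qed.

(** For [l] outside [I] multiplication follows differentiation, for [l] in [I] it precedes it; the
    two orders have eigenvalues al_a al_b and (al_a + 1)(al_b + 1). The latter is positive, so the
    sum can vanish only for [I = set0]. *)
Definition lapl I (al : 'X_{1..m}) : nat :=
  (\sum_l if l \in I then (al (a l)).+1 * (al (b l)).+1 else al (a l) * al (b l))%N.

Lemma lead_leP l al : (lead l <= al)%MM = (0 < al (a l))%N && (0 < al (b l))%N.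
Proof.
apply/mnm_lepP/andP => [h|[h1 h2] i].
  by have := h (a l); have := h (b l); rewrite lead_aa lead_bb.
rewrite leadE; have [<-|_] := eqVneq (a l) i.
  by rewrite eq_sym (negPf (a_neq_b l)).
by have [<-|] := eqVneq (b l) i.
Qed.

Lemma lead_dlead_coef l p al :
  ('X_[lead l] * dlead l p)@_al = p@_al *+ (al (a l) * al (b l)).
Proof.
rewrite mcoeffXM; case: (boolP (lead l <= al)%MM) => h.
  rewrite mcoeff_dlead submK // !mnmBE lead_aa lead_bb.
  by move: h; rewrite lead_leP => /andP[h1 h2]; rewrite !subn1 !prednK.
move: h; rewrite lead_leP negb_and -!eqn0Ngt => /orP[]/eqP ->;
by rewrite ?mul0n ?muln0 mulr0n.
Qed.

Lemma dlead_lead_coef l p al :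
  (dlead l ('X_[lead l] * p))@_al = p@_al *+ ((al (a l)).+1 * (al (b l)).+1).
Proof. by rewrite mcoeff_dlead mcoeffXM lem_addl addmK. Qed.

Local Notation X := (fun l => 'X_[lead l] : S_).

Lemma homot_laplace k I al :
  (koszul_d X (homot k) I + homot (koszul_d X k) I)@_al = (k I)@_al *+ lapl I al.
Proof.
have contr_homot l : contr l (homot k) I = \sum_l' dlead l' (contr l (wedge l' k) I).
  by rewrite /homot contr_sum; apply: eq_bigr => l' _; rewrite contr_map.
have wedge_d l : wedge l (koszul_d X k) I = \sum_l' X l' * wedge l (contr l' k) I.
  by rewrite /koszul_d wedge_sum; apply: eq_bigr => l' _; rewrite wedge_mul.
rewrite {1}/koszul_d /homot -/(homot k).
under eq_bigr => l _ do rewrite contr_homot mulr_sumr.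
under [in X in _ + X]eq_bigr => l _ do rewrite wedge_d linear_sum.
rewrite [X in _ + X]exchange_big -big_split /= /lapl -sumrMnr raddf_sum.
apply: eq_bigr => l _; rewrite -big_split /= (bigD1 l) //= big1 => [|l' nll'].
  rewrite addr0 contr_wedge_eq wedge_contr_eq; case: (l \in I).
    by rewrite linear0 mulr0 add0r dlead_lead_coef.
  by rewrite mulr0 linear0 addr0 lead_dlead_coef.
rewrite eq_sym in nll'.
by rewrite contr_wedge_neq // linearN mulrN /= dlead_mulX // addNr.
Qed.

(** Where the eigenvalue is 0 the division returns 0. This occurs only at [set0], where
    [koszul_exact] assumes that [k] vanishes. *)
Definition lapl_inv k : superpoly :=
  fun I => \sum_(al <- msupp (k I)) ((k I)@_al / (lapl I al)%:R) *: 'X_[al].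

Lemma mcoeff_lapl_inv k I al : (lapl_inv k I)@_al = (k I)@_al / (lapl I al)%:R.
Proof.
rewrite /lapl_inv raddf_sum /=.
under eq_bigr => be _ do rewrite mcoeffZ mcoeffX.
have [h|h] := boolP (al \in msupp (k I)).
  rewrite (bigD1_seq al) ?msupp_uniq //= eqxx mulr1 big1 ?addr0 // => be /negPf ->.
  by rewrite mulr0.
rewrite big_seq big1 => [|be hbe]; first by rewrite memN_msupp_eq0 // mul0r.
case: eqP => [e|_]; last by rewrite mulr0.
by rewrite -e hbe in h.
Qed.

Lemma lapl_invD k1 k2 I :
  lapl_inv (fun J => k1 J + k2 J) I = lapl_inv k1 I + lapl_inv k2 I.
Proof. by apply/mpolyP => al; rewrite mcoeffD !mcoeff_lapl_inv mcoeffD mulrDl. Qed.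

Lemma lapl_invN k I : lapl_inv (fun J => - k J) I = - lapl_inv k I.
Proof. by apply/mpolyP => al; rewrite mcoeffN !mcoeff_lapl_inv mcoeffN mulNr. Qed.

(** Moving [l] into [I] while lowering both its exponents by one exchanges the two kinds of summand
    without changing the value. Hence the differential preserves eigenvalues and commutes with
    [lapl_inv]. *)
Lemma lapl_lead I l al : l \notin I -> (lead l <= al)%MM ->
  lapl (l |: I) (al - lead l)%MM = lapl I al.
Proof.
move=> lI; rewrite lead_leP => /andP[h1 h2]; apply: eq_bigr => l' _.
rewrite in_setU1 !mnmBE; have [->|nl] := eqVneq l' l.
  by rewrite (negPf lI) /= lead_aa lead_bb !subn1 !prednK.
rewrite eq_sym in nl.
by rewrite /= lead_a // lead_b // !subn0.
Qed.

Lemma lapl_inv_d k I : koszul_d X (lapl_inv k) I = lapl_inv (koszul_d X k) I.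
Proof.
apply/mpolyP => al; rewrite mcoeff_lapl_inv; set lam := _%:R; rewrite !raddf_sum mulr_suml.
apply: eq_bigr => l _; rewrite /= !mcoeffXM; case: (boolP (lead l <= al)%MM) => h; last by rewrite mul0r.
rewrite /contr; case: (boolP (l \in I)) => lI; first by rewrite mcoeff0 mul0r.
by rewrite !mcoeffZ mcoeff_lapl_inv lapl_lead // -mulrA.
Qed.

Variable w : 'I_m -> nat.
Definition mweigh (al : 'X_{1..m}) : nat := (\sum_i w i * al i)%N.
Definition lead_weight l : nat := (w (a l) + w (b l))%N.
(** The exterior generator [l] weighs as much as its leading monomial. The differential and the
    homotopy built from the leading monomials then preserve the weight, and the differential built
    from lighter monomials lowers it. *)
Definition weight I al : nat := (mweigh al + \sum_(l in I) lead_weight l)%N.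

Definition weight_lt N k := forall I al, (k I)@_al != 0 -> (weight I al < N)%N.

Lemma mweighD al be : mweigh (al + be)%MM = (mweigh al + mweigh be)%N.
Proof.
by rewrite /mweigh -big_split; apply: eq_bigr => i _; rewrite mnmDE mulnDr.
Qed.

Lemma mweighU i : mweigh U_(i)%MM = w i.
Proof.
rewrite /mweigh (bigD1 i) //= mnm1E eqxx muln1 big1 ?addn0 // => j h.
by rewrite mnm1E eq_sym (negPf h) muln0.
Qed.

Lemma weightU1 I l al : l \notin I -> weight (l |: I) al = (weight I al + lead_weight l)%N.
Proof. by move=> h; rewrite /weight big_setU1 //= [(lead_weight l + _)%N]addnC addnA. Qed.

Lemma weight_ltD N k k' :
  weight_lt N k -> weight_lt N k' -> weight_lt N (fun I => k I + k' I).
Proof.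
move=> h h' I al; rewrite mcoeffD => nz.
have [e|] := eqVneq (k I)@_al 0; last exact: h.
by apply: h'; move: nz; rewrite e add0r.
Qed.

Lemma weight_ltN N k : weight_lt N k -> weight_lt N (fun I => - k I).
Proof. by move=> h I al; rewrite mcoeffN oppr_eq0; apply: h. Qed.

Lemma weight_lt_homot N k : weight_lt N k -> weight_lt N (homot k).
Proof.
move=> h I al; rewrite raddf_sum => /sum_neq0[l] /=.
rewrite mcoeff_dlead /wedge; case: (boolP (l \in I)) => [lI|_]; last by rewrite mcoeff0 mul0rn eqxx.
have [e|nz _] := eqVneq (k (I :\ l))@_(al + lead l) 0.
  by rewrite mcoeffZ e mulr0 mul0rn eqxx.
have := h _ _ nz; rewrite -{2}(setD1K lI) weightU1 ?setD11 //.
by rewrite /weight mweighD /lead mweighD !mweighU addnAC.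
Qed.

Lemma weight_lt_lapl_inv N k : weight_lt N k -> weight_lt N (lapl_inv k).
Proof.
move=> h I al; rewrite mcoeff_lapl_inv mulf_eq0 negb_or => /andP[nz _].
exact: h.
Qed.

Lemma weight_lt_d N k (q : 'I_r -> S_) :
  (forall l be, be \in msupp (q l) -> (mweigh be < lead_weight l)%N) ->
  weight_lt N.+1 k -> weight_lt N (koszul_d q k).
Proof.
move=> hq h I al; rewrite raddf_sum => /sum_neq0[l] /=.
rewrite /contr; case: (boolP (l \in I)) => [lI|lI]; first by rewrite mulr0 mcoeff0 eqxx.
rewrite -mcoeff_msupp => /msuppM_le/allpairsP[[be ga] /= [hbe hga ->]].
have nz : (k (l |: I))@_ga != 0.
  by move: hga; rewrite mcoeff_msupp mcoeffZ; apply: contraNneq => ->; rewrite mulr0.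
have := h _ _ nz; rewrite weightU1 // ltnS; apply: leq_trans.
by move: (hq _ _ hbe); rewrite /weight mweighD; lia.
Qed.

Lemma weight_lt_bound k : exists N, weight_lt N k.
Proof.
exists (\max_(I : {set 'I_r}) \max_(al <- msupp (k I)) weight I al).+1 => I al nz.
rewrite ltnS; apply: leq_trans (leq_bigmax I).
by apply: leq_bigmax_seq => //; rewrite mcoeff_msupp.
Qed.

(** Homological perturbation. Let [H] be the homotopy divided by the Laplacian, so that k = d_X (H
    k) + H (d_X k) in positive exterior degree. A cycle for d_X + d_q has d_X k = - d_q k, so
    subtracting the boundary of [H k] leaves - H (d_q k) - d_q (H k), whose weight is strictly
    smaller; the induction is on a strict bound for the weight. *)
Theorem koszul_exact (q : 'I_r -> S_) k :
  (forall l be, be \in msupp (q l) -> (mweigh be < lead_weight l)%N) ->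
  (forall I, koszul_d (fun l => 'X_[lead l] + q l) k I = 0) -> k set0 = 0 ->
  exists k', forall I, k I = koszul_d (fun l => 'X_[lead l] + q l) k' I.
Proof.
move=> hq; have [N] := weight_lt_bound k.
elim: N k => [|N IHN] k hN dk k0.
  exists (fun=> 0) => I; rewrite koszul_d0; apply/mpolyP => al.
  by rewrite mcoeff0; apply/eqP; apply: contraT => /hN.
set Q := fun l => _ in dk *.
pose H k : superpoly := lapl_inv (homot k).
have HN N' k' : weight_lt N' k' -> weight_lt N' (H k').
  by move=> h; apply/weight_lt_lapl_inv/weight_lt_homot.
have QE k' I : koszul_d Q k' I = koszul_d X k' I + koszul_d q k' I by exact: koszul_dDl.
have HD k1 I : H (fun J => - k1 J) I = - H k1 I.
  rewrite /H -lapl_invN; congr lapl_inv; apply/funext => J.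
  rewrite /homot -sumrN; apply: eq_bigr => l _.
  by rewrite -linearN; congr dlead; rewrite /wedge; case: (l \in J); rewrite ?oppr0 ?scalerN.
have kE I : k I = koszul_d X (H k) I + H (koszul_d X k) I.
  rewrite /H lapl_inv_d -lapl_invD; apply/mpolyP => al.
  rewrite mcoeff_lapl_inv homot_laplace -(mulr_natr (k I)@_al).
  have [->|/set0Pn[l lI]] := eqVneq I set0; first by rewrite k0 mcoeff0 !mul0r.
  rewrite mulfK // pnatr_eq0 /lapl (bigD1 l) //= lI -lt0n addn_gt0.
  by rewrite muln_gt0.
have dXk : koszul_d X k = (fun J => - koszul_d q k J).
  by apply/funext => I; apply/eqP; rewrite -addr_eq0 -QE dk.
have k'E I : k I - koszul_d Q (H k) I = - H (koszul_d q k) I + - koszul_d q (H k) I.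
  by rewrite QE opprD addrA {1}kE dXk HD [_ + - H _ _]addrC addrK.
have H0 k1 I : wedge ^~ k1 ^~ I = (fun=> 0) -> H k1 I = 0.
  move=> h; apply/mpolyP => al; rewrite mcoeff_lapl_inv /homot raddf_sum big1 ?mul0r ?mcoeff0 //.
  by move=> l _; rewrite -[wedge _ _ _]/((wedge ^~ k1 ^~ I) l) h /= linear0 /= mcoeff0.
have H00 k1 : H k1 set0 = 0.
  by apply: H0; apply/funext => l; rewrite /wedge in_set0.
(* The remainder must again vanish at [set0]. Its [d_q] part there involves [H k] on singletons,
   which comes from [k set0] alone. *)
have qH0 : koszul_d q (H k) set0 = 0.
  rewrite /koszul_d big1 // => l _; rewrite /contr in_set0 setU0 H0 ?scaler0 ?mulr0 //.
  apply/funext => l'; rewrite /wedge; case: (boolP (l' \in [set l])) => // /set1P ->.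
  by rewrite setDv k0 scaler0.
have [k1 k1E] : exists k1, forall I, k I - koszul_d Q (H k) I = koszul_d Q k1 I.
  apply: IHN => [|I|].
  - rewrite (_ : (fun I => _) = (fun I => - H (koszul_d q k) I + - koszul_d q (H k) I)); last first.
      by apply/funext => I; exact: k'E.
    apply: weight_ltD; apply: weight_ltN; last exact/weight_lt_d/HN.
    exact/HN/weight_lt_d.
  - by rewrite koszul_dB dk koszul_dd subrr.
  - by rewrite k'E H00 qH0 oppr0 addr0.
by exists (fun J => H k J + k1 J) => I; rewrite koszul_dD -k1E addrC subrK.
Qed.
End KoszulComplex.

(** * Two-step nilpotent Lie superalgebras *)

Section QuadraticLie.
Variables (F : numFieldType) (m r : nat) (B : 'I_r -> 'M[F]_m).
Hypothesis B_sym : forall l i j, B l i j = B l j i.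

Local Notation Lsort := ('rV[F]_m * 'rV[F]_r)%type.

Definition ql_hom (k : nat) (u : Lsort) : Prop :=
  match k with 1 => u.2 = 0 | 2 => u.1 = 0 | _ => u = 0 end.

Definition ql_form (l : 'I_r) (u v : 'rV[F]_m) : F := \sum_i \sum_j B l i j * u 0 i * v 0 j.

Definition ql_br (u v : Lsort) : Lsort := (0, \row_l ql_form l u.1 v.1).

Lemma ql_formDl l a u v w : ql_form l (a *: u + v) w = a * ql_form l u w + ql_form l v w.
Proof.
rewrite /ql_form mulr_sumr -big_split; apply: eq_bigr => i _ /=.
rewrite mulr_sumr -big_split; apply: eq_bigr => j _ /=.
by rewrite !mxE; ring.
Qed.

Lemma ql_form_sym l u v : ql_form l u v = ql_form l v u.
Proof.
rewrite /ql_form exchange_big; apply: eq_bigr => i _; apply: eq_bigr => j _.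
by rewrite B_sym mulrAC.
Qed.

Lemma ql_form0 l u : ql_form l 0 u = 0.
Proof. by rewrite /ql_form big1 // => i _; rewrite big1 // => j _; rewrite mxE mulr0 mul0r. Qed.

Lemma ql_br_sym u v : ql_br u v = ql_br v u.
Proof. by congr (_, _); apply/rowP => l; rewrite !mxE ql_form_sym. Qed.

Lemma ql_brDl a u v w : ql_br (a *: u + v) w = a *: ql_br u w + ql_br v w.
Proof.
congr (_, _); first by rewrite /= scaler0 addr0.
by apply/rowP => l; rewrite !mxE ql_formDl.
Qed.

Lemma ql_brDr a u v w : ql_br w (a *: u + v) = a *: ql_br w u + ql_br w v.
Proof. by rewrite ![ql_br w _]ql_br_sym ql_brDl. Qed.

Lemma ql_br0 u v : u.1 = 0 -> ql_br u v = 0.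
Proof. by move=> h; congr (_, _); apply/rowP => l; rewrite !mxE h ql_form0. Qed.

Lemma ql_br0r u v : v.1 = 0 -> ql_br u v = 0.
Proof. by rewrite ql_br_sym; apply: ql_br0. Qed.

Lemma ql_hom_subspace k : subspace (ql_hom k).
Proof.
split; first by case: k => [|[|[|k]]].
by case: k => [|[|[|k]]] a u v /=; [move=> -> ->|move=> -> ->|move=> -> ->|move=> -> ->];
  rewrite scaler0 addr0.
Qed.

Lemma ql_hom1 k u : ql_hom k u -> k <> 1%N -> u.1 = 0.
Proof. by case: k => [|[|[|k]]] //= ->. Qed.

Lemma ql_hom2 k u : ql_hom k u -> k <> 2 -> u.2 = 0.
Proof. by case: k => [|[|[|k]]] //= ->. Qed.

Lemma ql_graded : graded ql_hom.
Proof.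
split=> [k|v|n c hc c0 k ltkn]; first exact: ql_hom_subspace.
  exists 3, (fun k => match k return Lsort with 1 => (v.1, 0) | 2 => (0, v.2) | _ => 0 end).
  split; first by case=> [|[|[|k]]].
  rewrite !big_ord_recr big_ord0 /= !add0r; case: v => a b.
  by congr (_, _); rewrite /= ?addr0 ?add0r.
have s1 : (c k).1 = if k == 1%N then (\sum_(k < n) c k).1 else 0.
  case: eqP => [e|ne]; last exact: ql_hom1 (hc k) ne.
  rewrite (big_morph (fun x : Lsort => x.1) (id1 := 0) (op1 := +%R)) //.
  rewrite (bigD1 (Ordinal ltkn)) //= big1 ?addr0 // => i hi.
  by apply: ql_hom1 (hc i) _ => ei; case/eqP: hi; apply: val_inj; rewrite /= ei.
have s2 : (c k).2 = if k == 2%N then (\sum_(k < n) c k).2 else 0.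
  case: eqP => [e|ne]; last exact: ql_hom2 (hc k) ne.
  rewrite (big_morph (fun x : Lsort => x.2) (id1 := 0) (op1 := +%R)) //.
  rewrite (bigD1 (Ordinal ltkn)) //= big1 ?addr0 // => i hi.
  by apply: ql_hom2 (hc i) _ => ei; case/eqP: hi; apply: val_inj; rewrite /= ei.
by rewrite [LHS]surjective_pairing s1 s2 c0; case: (k == _); case: (k == _).
Qed.

Lemma ql_hom0 u : ql_hom 0 u -> u = 0. Proof. by []. Qed.

Lemma ql_br_hom i j u v : ql_hom i u -> ql_hom j v -> ql_hom (i + j) (ql_br u v).
Proof.
have h0 k : ql_hom k 0 by case: (ql_hom_subspace k).
case: (eqVneq i 1%N) => [->|/eqP ni hu _]; last first.
  by rewrite ql_br0 //; apply: ql_hom1 hu ni.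
case: (eqVneq j 1%N) => [->|/eqP nj _ hv]; first by [].
by rewrite ql_br0r //; apply: ql_hom1 hv nj.
Qed.

Lemma ql_antisym i j u v : ql_hom i u -> ql_hom j v ->
  ql_br u v = - ((-1) ^+ (i * j)%N *: ql_br v u).
Proof.
case: (eqVneq i 1%N) => [->|/eqP ni hu _]; last first.
  have h := ql_hom1 hu ni.
  by rewrite ql_br0 // ql_br0r // scaler0 oppr0.
case: (eqVneq j 1%N) => [-> _ _|/eqP nj _ hv]; last first.
  have h := ql_hom1 hv nj.
  by rewrite ql_br0r // ql_br0 // scaler0 oppr0.
by rewrite expr1 scaleN1r opprK ql_br_sym.
Qed.

Lemma ql_jacobi i j u v w : ql_hom i u -> ql_hom j v ->
    ql_br u (ql_br v w) =
      ql_br (ql_br u v) w + (-1) ^+ (i * j)%N *: ql_br v (ql_br u w).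
Proof. by rewrite ql_br0r // ql_br0 // ql_br0r // scaler0 addr0. Qed.

Definition qlie : lie_superalgebra F :=
  LieSuperalgebra ql_graded ql_hom0 ql_brDl ql_brDr ql_br_hom ql_antisym ql_jacobi.

End QuadraticLie.

(** * Cochains *)

Section Cochains.
Variables (F : numFieldType) (L : lie_superalgebra F).
Implicit Types (om : seq L -> F) (s : seq L) (ks : seq nat).

Lemma cochain0 om s1 s2 : cochain om -> om (s1 ++ 0 :: s2) = 0.
Proof.
case=> h _ _; have := h s1 s2 1 0 0; rewrite scaler0 addr0 mul1r.
by move/eqP; rewrite -[X in X == _]addr0 (inj_eq (addrI _)) eq_sym => /eqP.
Qed.

Lemma cochain_cons om u : cochain om -> cochain (fun s => om (u :: s)).
Proof.
move=> [h1 h2 [n hn]]; split=> [s1 s2 a v w|s1 s2 i j v w|].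
- exact: (h1 (u :: s1)).
- exact: (h2 (u :: s1)).
by exists n => s hs; apply: hn; exact: ltnW.
Qed.

Lemma homogeneous_cons k ks u s :
  homogeneous (k :: ks) (u :: s) <-> lie_hom k u /\ homogeneous ks s.
Proof.
split=> [[[e] h]|[hu [e h]]].
  by split; [exact: (h 0%N)|split=> // i hi; exact: (h i.+1)].
by split=> [|[|i] hi]; rewrite /= ?e //; apply: h.
Qed.

Lemma homogeneous_cat ks1 ks2 s1 s2 :
  homogeneous ks1 s1 -> homogeneous ks2 s2 -> homogeneous (ks1 ++ ks2) (s1 ++ s2).
Proof.
elim: s1 ks1 => [|u s1 IH] [|k ks1] h1 h2 //; try by case: h1.
have [hu h] := (homogeneous_cons _ _ _ _).1 h1.
by apply/homogeneous_cons; split=> //; apply: IH.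
Qed.

Lemma homogeneous_take j ks s : homogeneous ks s -> homogeneous (take j ks) (take j s).
Proof.
elim: s ks j => [|u s IH] [|k ks] [|j] h //; try by case: h.
have [hu h'] := (homogeneous_cons _ _ _ _).1 h.
by apply/homogeneous_cons; split=> //; apply: IH.
Qed.

Lemma homogeneous_drop j ks s : homogeneous ks s -> homogeneous (drop j ks) (drop j s).
Proof.
elim: j s ks => [|j IH] s ks h; first by rewrite !drop0.
case: s ks h => [|u s] [|k ks] h //; try by case: h.
by apply: IH; have [_] := (homogeneous_cons _ _ _ _).1 h.
Qed.

Lemma homogeneous_remove j ks s : homogeneous ks s ->
  homogeneous (take j ks ++ drop j.+1 ks) (take j s ++ drop j.+1 s).
Proof.
by move=> h; apply: homogeneous_cat; [exact: homogeneous_take|exact: homogeneous_drop].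
Qed.

Lemma size_remove (T : Type) j (s : seq T) : (j < size s)%N ->
  size s = (size (take j s ++ drop j.+1 s)).+1.
Proof. by move=> h; rewrite size_cat size_take size_drop h; lia. Qed.

(** Each of the j transpositions passes an argument of some degree d and costs the sign -(-1)^(d
    k_j). *)
Lemma cochain_move om ks s j : cochain om -> homogeneous ks s -> (j < size s)%N ->
  om (s`_j :: take j s ++ drop j.+1 s) =
    (-1) ^+ (j + nth 0 ks j * sumn (take j ks))%N * om s.
Proof.
elim: s ks j om => [|u s IH] [|k ks] [|j] om hom hs // ltj; try by case: hs.
  by rewrite /= drop0 muln0 mul1r.
have [hu hs'] := (homogeneous_cons _ _ _ _).1 hs.
have hj : lie_hom (nth 0%N ks j) s`_j by case: hs' => _; apply.
case: (hom) => _ hsw _.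
rewrite /= (hsw [::] _ _ _ _ _ hj hu) /=.
have -> := IH ks j (fun s => om (u :: s)) (cochain_cons u hom) hs' ltj.
rewrite mulrA -exprD -mulN1r mulrA -exprS; congr (_ * _).
by rewrite -[LHS]signr_odd -[RHS]signr_odd; congr (_ ^+ _); lia.
Qed.

Lemma CE_diff_cons om k ks u s : cochain om -> homogeneous (k :: ks) (u :: s) ->
  CE_diff om (k :: ks) (u :: s) =
    - (\sum_(j < size s) (-1) ^+ (j + nth 0 ks j * sumn (take j ks))%N *
        om (lie_br u s`_j :: take j s ++ drop j.+1 s))
    - CE_diff (fun s => om (u :: s)) ks s.
Proof.
move=> hom hs; have [hu hs'] := (homogeneous_cons _ _ _ _).1 hs.
rewrite /CE_diff big_ord_recl big_ord0 add0r -!sumrN -big_split.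
apply: eq_bigr => j _; rewrite /= /bump leq0n add1n big_ord_recl; congr (_ + _).
  rewrite /= !drop0 /= -[RHS]mulN1r mulrA -exprS; congr (_ * _).
  rewrite -[LHS]signr_odd -[RHS]signr_odd; congr (_ ^+ nat_of_bool _); rewrite !(oddD, oddM, oddS) /=.
  by move: (odd j) (odd k) (odd (nth 0%N ks j)) (odd (sumn _)) => [] [] [] [].
rewrite -sumrN; apply: eq_bigr => i _ /=; rewrite /bump leq0n add1n /=.
have hi' : (i < size s)%N by apply: ltn_trans (ltn_ord j); case: i.
have hi : lie_hom (nth 0%N ks i) s`_i by case: hs' => _; apply.
have hj : lie_hom (nth 0%N ks j) s`_j by case: hs' => _; apply.
case: (hom) => _ hsw _.
rewrite (hsw [::] _ _ _ _ _ (lie_br_hom hi hj) hu) /=.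
rewrite mulrN mulrA -exprD; congr (- (_ * _)).
rewrite -[LHS]signr_odd -[RHS]signr_odd; congr (_ ^+ nat_of_bool _); rewrite !(oddD, oddM, oddS) /=.
by move: (odd i) (odd j) (odd k) (odd (nth 0%N ks i)) (odd (nth 0%N ks j)) (odd (sumn (take i ks)))
  (odd (sumn (take j ks))) => [] [] [] [] [] [] [].
Qed.

(** Cochains are compared on homogeneous lists only; the differential respects this because
    bracketing and omitting arguments keep a list homogeneous. *)
Lemma CE_diff_ext om om' ks s : (forall ks s, homogeneous ks s -> om s = om' s) ->
  homogeneous ks s -> CE_diff om ks s = CE_diff om' ks s.
Proof.
move=> h hs; apply: eq_bigr => j _; apply: eq_bigr => i _; congr (_ * _).
have hi' : (i < size s)%N by apply: ltn_trans (ltn_ord j).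
have hi : lie_hom (nth 0%N ks i) s`_i by case: hs => _; apply.
have hj : lie_hom (nth 0%N ks j) s`_j by case: hs => _; apply.
apply: (h (_ :: (take i ks ++ drop i.+1 (take j ks) ++ drop j.+1 ks))%SEQ).
apply/homogeneous_cons; split; first exact: lie_br_hom hi hj.
apply: homogeneous_cat; first exact: homogeneous_take.
apply: homogeneous_cat; last exact: homogeneous_drop.
exact/homogeneous_drop/homogeneous_take.
Qed.
End Cochains.

(** * Superpolynomials as cochains *)

Section Transform.
Variables (F : numFieldType) (m r : nat).
Local Notation S_ := (mpoly.mpoly m F).
Local Notation superpoly := ({set 'I_r} -> S_).
Local Notation Lsort := ('rV[F]_m * 'rV[F]_r)%type.
Implicit Types (k : superpoly) (I : {set 'I_r}) (l : 'I_r) (p q : S_).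
Implicit Types (x y : 'rV[F]_m) (u v : Lsort) (s : seq Lsort).

Definition dderiv x p : S_ := \sum_i x 0 i *: p^`M(i).

Lemma dderiv_linear x : linear (dderiv x).
Proof.
move=> c p q; rewrite /dderiv scaler_sumr -big_split; apply: eq_bigr => i _ /=.
by rewrite linearP scalerDr !scalerA mulrC.
Qed.
HB.instance Definition _ x :=
  GRing.isLinear.Build F S_ S_ _ (dderiv x) (dderiv_linear x).

Lemma dderivZ x c p : dderiv x (c *: p) = c *: dderiv x p.
Proof. exact: linearZ. Qed.

Lemma dderivDl c x y p : dderiv (c *: x + y) p = c *: dderiv x p + dderiv y p.
Proof.
rewrite /dderiv scaler_sumr -big_split; apply: eq_bigr => i _ /=.
by rewrite !mxE scalerDl scalerA.
Qed.

Lemma dderivM x p q : dderiv x (p * q) = dderiv x p * q + p * dderiv x q.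
Proof.
rewrite /dderiv mulr_suml mulr_sumr -big_split; apply: eq_bigr => i _ /=.
by rewrite mderivM scalerDr scalerAl scalerAr.
Qed.

Lemma dderivC x y p : dderiv x (dderiv y p) = dderiv y (dderiv x p).
Proof.
rewrite {1}/dderiv [RHS]/dderiv.
under eq_bigr => i _ do rewrite (linear_sum (mderiv i)) scaler_sumr.
under [RHS]eq_bigr => i _ do rewrite (linear_sum (mderiv i)) scaler_sumr.
rewrite exchange_big; apply: eq_bigr => j _; apply: eq_bigr => i _ /=.
by rewrite !linearZ /= mderiv_comm !scalerA mulrC.
Qed.

Lemma dderiv_0 p : dderiv 0 p = 0.
Proof. by rewrite /dderiv big1 // => i _; rewrite mxE scale0r. Qed.

Lemma mderiv_X (i j : 'I_m) : ('X_j : S_)^`M(i) = (j == i)%:R%:MP.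
Proof.
rewrite mderivX mnm1E; case: eqP => [->|_]; last by rewrite scale0r.
by rewrite -{1}[U_(i)%MM]add0m addmK mpolyX0 scale1r.
Qed.

Lemma dderivX x j : dderiv x 'X_j = (x 0 j)%:MP.
Proof.
rewrite /dderiv (bigD1 j) //= big1 => [|i ij].
  by rewrite addr0 mderiv_X eqxx -mul_mpolyC mulr1.
by rewrite mderiv_X eq_sym (negPf ij) scaler0.
Qed.

Definition linform x : S_ := \sum_j x 0 j *: 'X_j.

Lemma linform_mcoeff0 x p : (linform x * p)@_0 = 0.
Proof.
rewrite /linform mulr_suml raddf_sum big1 // => j _ /=.
rewrite -scalerAl mcoeffZ mcoeffXM lep1mP mnm0E /= mulr0 //.
Qed.

Lemma dderiv_linform x y : dderiv x (linform y) = (\sum_i y 0 i * x 0 i)%:MP.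
Proof.
rewrite /linform linear_sum /= raddf_sum; apply: eq_bigr => j _.
by rewrite linearZ /= dderivX -mul_mpolyC -mpolyCM.
Qed.

Definition parity I : F := (-1) ^+ #|I|.

Lemma parityU1 l I : l \notin I -> parity (l |: I) = - parity I.
Proof. by move=> h; rewrite /parity cardsU1 h exprS mulN1r. Qed.

Lemma parityD1 l I : l \in I -> parity (I :\ l) = - parity I.
Proof. by move=> h; rewrite -{2}(setD1K h) parityU1 ?setD11 // opprK. Qed.

Lemma parity_sq I : parity I * parity I = 1.
Proof. by rewrite -expr2 /parity sqrr_sign. Qed.

Lemma contr_parity l k I :
  contr l (fun J => parity J *: k J) I = - (parity I *: contr l k I).
Proof.
rewrite /contr; case: (boolP (l \in I)) => lI; first by rewrite scaler0 oppr0.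
by rewrite parityU1 // scaleNr scalerN !scalerA mulrC.
Qed.

Lemma wedge_parity l k I :
  wedge l (fun J => parity J *: k J) I = - (parity I *: wedge l k I).
Proof.
rewrite /wedge; case: (boolP (l \in I)) => lI; last by rewrite scaler0 oppr0.
by rewrite parityD1 // scaleNr scalerN !scalerA mulrC.
Qed.

(* Contraction with an element of L: on the odd part a derivation of the polynomials,
   on the even part an odd derivation of the exterior factor; the parity makes the two
   anticommute. *)
Definition contraction u k : superpoly :=
  fun I => parity I *: dderiv u.1 (k I) + \sum_l u.2 0 l *: contr l k I.

Lemma contraction_linear u c k k' :
  contraction u (fun J => c *: k J + k' J) =
  (fun I => c *: contraction u k I + contraction u k' I).
Proof.
apply/funext => I; rewrite /contraction linearP scalerDr (scalerA _ c) (mulrC _ c) -scalerA.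
rewrite scalerDr addrACA; congr (_ + _).
rewrite scaler_sumr -big_split; apply: eq_bigr => l _ /=.
by rewrite contr_linear scalerDr !scalerA (mulrC c).
Qed.

Lemma contractionDl c u v k I :
  contraction (c *: u + v) k I = c *: contraction u k I + contraction v k I.
Proof.
rewrite /contraction dderivDl scalerDr (scalerA _ c) (mulrC _ c) -scalerA.
rewrite scalerDr addrACA; congr (_ + _).
rewrite scaler_sumr -big_split; apply: eq_bigr => l _ /=.
by rewrite !mxE scalerDl scalerA.
Qed.

(** On polynomials this is full polarisation without division by a factorial, so that a product of
    variables becomes exactly the product of the coordinate 1-cochains ([cup_forms_scal]). *)
Fixpoint cform k s : F :=
  if s is u :: s' then cform (contraction u k) s' else (k set0)@_0.

Lemma cform_linear c k k' s :
  cform (fun J => c *: k J + k' J) s = c * cform k s + cform k' s.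
Proof.
elim: s k k' => [|u s IH] k k' /=; first by rewrite mcoeffD mcoeffZ.
by rewrite contraction_linear IH.
Qed.

Lemma cform0 s : cform (fun=> 0) s = 0.
Proof.
have := cform_linear (-1) (fun=> 0) (fun=> 0) s; rewrite mulN1r addNr => <-.
by congr cform; apply/funext => I; rewrite scaler0 addr0.
Qed.

Lemma cformZ c k s : cform (fun J => c *: k J) s = c * cform k s.
Proof.
have := cform_linear c k (fun=> 0) s; rewrite cform0 addr0 => <-.
by congr cform; apply/funext => I; rewrite addr0.
Qed.

Lemma cformD k k' s : cform (fun J => k J + k' J) s = cform k s + cform k' s.
Proof.
have := cform_linear 1 k k' s; rewrite mul1r => <-.
by congr cform; apply/funext => I; rewrite scale1r.
Qed.

Lemma cformN k s : cform (fun J => - k J) s = - cform k s.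
Proof. by rewrite -mulN1r -cformZ; congr cform; apply/funext => I; rewrite scaleN1r. Qed.

Lemma cform_sum (T : Type) (t : seq T) (f : T -> superpoly) s :
  cform (fun J => \sum_(i <- t) f i J) s = \sum_(i <- t) cform (f i) s.
Proof.
elim: t => [|i t IH].
  by rewrite big_nil -(cform0 s); congr cform; apply/funext => I; rewrite big_nil.
rewrite big_cons -IH -cformD; congr cform; apply/funext => I.
by rewrite big_cons.
Qed.

Lemma contraction_swap i j u v k : ql_hom i u -> ql_hom j v ->
  contraction v (contraction u k) =
  (fun I => - ((-1) ^+ (i * j)%N *: contraction u (contraction v k) I)).
Proof.
have odd1 u' k' : u'.2 = 0 -> contraction u' k' = fun I => parity I *: dderiv u'.1 (k' I).
  move=> e; apply/funext => I; rewrite /contraction big1 ?addr0 // => l _.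
  by rewrite e mxE scale0r.
have even1 u' k' : u'.1 = 0 -> contraction u' k' = fun I => \sum_l u'.2 0 l *: contr l k' I.
  by move=> e; apply/funext => I; rewrite /contraction e dderiv_0 scaler0 add0r.
have mixed u' v' k' I : u'.2 = 0 -> v'.1 = 0 ->
    contraction v' (contraction u' k') I = - contraction u' (contraction v' k') I.
  move=> hu hv; rewrite !(odd1 u') // !(even1 v') //.
  rewrite (linear_sum (dderiv _)) scaler_sumr -sumrN; apply: eq_bigr => l _.
  by rewrite /= contr_parity contr_map dderivZ scalerN !scalerA mulrC.
have zero1 k' : contraction 0 k' = fun=> 0.
  by rewrite odd1 //; apply/funext => I; rewrite dderiv_0 scaler0.
have zero2 u' : contraction u' (fun=> 0) = fun=> 0.
  apply/funext => I; rewrite /contraction linear0 scaler0 add0r big1 // => l _.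
  by rewrite /contr; case: (l \in I); rewrite ?scaler0.
move=> hu hv; apply/funext => I.
have [ei|/eqP ni] := eqVneq i 1%N; have [ej|/eqP nj] := eqVneq j 1%N.
- subst; rewrite !(odd1 u) // !(odd1 v) // !dderivZ dderivC.
  by rewrite expr1 scaleN1r opprK.
- subst; have hv1 := ql_hom1 hv nj; have [e2|/eqP n2] := eqVneq j 2.
    by rewrite mixed // e2 expr2 mulrNN mulr1 scale1r.
  have -> : v = 0 by rewrite [v]surjective_pairing hv1 (ql_hom2 hv n2).
  by rewrite !zero1 zero2 scaler0 oppr0.
- subst; have hu1 := ql_hom1 hu ni; have [e2|/eqP n2] := eqVneq i 2.
    by rewrite [X in - (_ *: X)]mixed // e2 muln1 expr2 mulrNN mulr1 scale1r opprK.
  have -> : u = 0 by rewrite [u]surjective_pairing hu1 (ql_hom2 hu n2).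
  by rewrite !zero1 zero2 scaler0 oppr0.
have hv1 := ql_hom1 hv nj; have hu1 := ql_hom1 hu ni.
have [e2|/eqP n2] := eqVneq j 2; last first.
  have -> : v = 0 by rewrite [v]surjective_pairing hv1 (ql_hom2 hv n2).
  by rewrite !zero1 zero2 scaler0 oppr0.
rewrite e2 mulnC exprM sqrrN expr1n expr1n scale1r !(even1 u) // !(even1 v) //.
under eq_bigr => l _ do rewrite contr_sum scaler_sumr.
under [in RHS]eq_bigr => l _ do rewrite contr_sum scaler_sumr.
rewrite exchange_big -sumrN; apply: eq_bigr => l _; rewrite -sumrN; apply: eq_bigr => l' _ /=.
have contrZ l1 c k1 : contr l1 (fun J => c *: k1 J) I = c *: contr l1 k1 I.
  by rewrite /contr; case: (l1 \in I); rewrite ?scaler0 // !scalerA mulrC.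
by rewrite !contrZ contr_anticomm !scalerN !scalerA mulrC.
Qed.
End Transform.

(** * The Chevalley-Eilenberg differential as a Koszul differential *)

Section FormCochains.
Variables (F : numFieldType) (m r : nat) (B : 'I_r -> 'M[F]_m).
Hypothesis B_sym : forall l i j, B l i j = B l j i.
Local Notation S_ := (mpoly.mpoly m F).
Local Notation superpoly := ({set 'I_r} -> S_).
Local Notation Lsort := ('rV[F]_m * 'rV[F]_r)%type.
Local Notation L := (qlie B_sym).
Implicit Types (k : superpoly) (I : {set 'I_r}) (l : 'I_r) (p q : S_).
Implicit Types (x y : 'rV[F]_m) (u v : Lsort) (s : seq Lsort).

(** Total degree, polynomial plus exterior. Each contraction lowers it, which bounds the length of
    the lists on which [cform k] can be nonzero. *)
Definition deg_lt N k := forall I al, (k I)@_al != 0 -> (mdeg al + #|I| < N)%N.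

Lemma deg_lt_contraction N u k : deg_lt N.+1 k -> deg_lt N (contraction u k).
Proof.
move=> h I al; rewrite /contraction mcoeffD => nz.
have [e|] := eqVneq (parity F I *: dderiv u.1 (k I))@_al 0.
  move: nz; rewrite e add0r mcoeff_sum => /sum_neq0[l] /=.
  rewrite mcoeffZ mulf_eq0 negb_or => /andP[_].
  rewrite /contr; case: (boolP (l \in I)) => lI; first by rewrite mcoeff0 eqxx.
  rewrite mcoeffZ mulf_eq0 negb_or => /andP[_] /h.
  by rewrite cardsU1 lI add1n addnS ltnS.
rewrite mcoeffZ mulf_eq0 negb_or => /andP[_].
rewrite /dderiv mcoeff_sum => /sum_neq0[t] /=.
rewrite mcoeffZ mulf_eq0 negb_or => /andP[_].
rewrite mcoeff_mderiv -mulr_natr mulf_eq0 negb_or => /andP[/h + _].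
by rewrite mdegD mdeg1 addn1 addSn ltnS.
Qed.

Lemma deg_lt_bound k : exists N, deg_lt N k.
Proof.
exists (\max_(I : {set 'I_r}) \max_(al <- msupp (k I)) (mdeg al + #|I|)).+1 => I al nz.
rewrite ltnS; apply: leq_trans (leq_bigmax I).
by apply: leq_bigmax_seq => //; rewrite mcoeff_msupp.
Qed.

Lemma cform_long N k s : deg_lt N k -> (N <= size s)%N -> cform k s = 0.
Proof.
elim: N k s => [|N IH] k s h hs.
  rewrite (_ : k = fun=> 0) ?cform0 //; apply/funext => I; apply/mpolyP => al.
  by rewrite mcoeff0; apply/eqP; apply: contraT => /h.
case: s hs => // u s hs; apply: (IH (contraction u k) s) => //; exact: deg_lt_contraction.
Qed.

Lemma cform_cochain k : cochain (L := L) (cform k).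
Proof.
split=> [s1 s2 a u v|s1 s2 i j u v hu hv|].
- elim: s1 k => [|t s1 IH] k /=; last exact: IH.
  rewrite -cform_linear; congr cform; apply/funext => I; exact: contractionDl.
- elim: s1 k => [|t s1 IH] k /=; last exact: IH.
  rewrite (contraction_swap k hu hv) cformN cformZ //.
have [N hN] := deg_lt_bound k.
by exists N => s hs; apply: cform_long hN _; exact: ltnW.
Qed.

(** Product with the odd coordinate 1-cochain given by [x]. As in [contraction], the parity factor
    is the sign of passing the exterior generators. *)
Definition linmul x k : superpoly := fun I => parity F I *: (linform x * k I).

Definition pair_row x y : F := \sum_i x 0 i * y 0 i.

Lemma contraction_linmul u x k I :
  contraction u (linmul x k) I =
    pair_row x u.1 *: k I + linmul x (contraction (u.1, - u.2) k) I.
Proof.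
rewrite /contraction /linmul /= dderivZ scalerA parity_sq scale1r dderivM dderiv_linform.
rewrite mul_mpolyC -addrA; congr (_ + _).
rewrite mulrDr scalerDr -scalerAr scalerA parity_sq scale1r; congr (_ + _).
rewrite mulr_sumr scaler_sumr; apply: eq_bigr => l _.
by rewrite contr_parity contr_mul mxE scalerN scaleNr mulrN scalerN -scalerAr !scalerA mulrC.
Qed.

Lemma contraction_wedge u l k I :
  contraction u (wedge l k) I = u.2 0 l *: k I - wedge l (contraction u k) I.
Proof.
have -> : wedge l (contraction u k) I =
   - (parity F I *: wedge l (fun J => dderiv u.1 (k J)) I)
   + \sum_l' u.2 0 l' *: wedge l (contr l' k) I.
  rewrite -wedge_parity -[X in _ = _ + X](_ : wedge l (fun J => \sum_l' u.2 0 l' *: contr l' k J) I = _).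
    by rewrite /wedge; case: (l \in I); rewrite ?addr0 // -scalerDr.
  rewrite wedge_sum; apply: eq_bigr => l' _.
  by rewrite /wedge; case: (l \in I); rewrite ?scaler0 // !scalerA mulrC.
rewrite /contraction wedge_map opprD opprK addrCA; congr (_ + _).
rewrite (bigD1 l) //= [in RHS](bigD1 l) //= opprD addrA; congr (_ + _).
  rewrite contr_wedge_eq wedge_contr_eq -scalerBr.
  by case: (l \in I); rewrite ?subrr ?subr0.
rewrite -sumrN; apply: eq_bigr => l' h.
by rewrite contr_wedge_neq // scalerN.
Qed.

(** Passing an argument through [linmul] reverses its even part; on homogeneous arguments this is a
    mere sign, the one that accumulates in [cform_linmul]. *)
Lemma hom_twist d u : ql_hom d u -> (u.1, - u.2) = - ((-1) ^+ d *: u) :> Lsort.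
Proof.
case: d => [|[|[|d]]] /= h.
- by rewrite h /= oppr0 scaler0 oppr0.
- by rewrite expr1 scaleN1r opprK h oppr0 -h -surjective_pairing.
- by rewrite expr2 mulrNN mulr1 scale1r [in RHS](surjective_pairing u) h /= -{1}oppr0.
- by rewrite h /= oppr0 scaler0 oppr0.
Qed.

Lemma contractionN u k I : contraction (- u) k I = - contraction u k I.
Proof.
have := contractionDl (-1) u 0 k I; rewrite addr0 !scaleN1r => ->.
rewrite [X in _ + X](_ : _ = 0) ?addr0 //.
rewrite /contraction dderiv_0 scaler0 add0r big1 // => l _; by rewrite mxE scale0r.
Qed.

Lemma contractionZ c u k I : contraction (c *: u) k I = c *: contraction u k I.
Proof.
have := contractionDl c u 0 k I; rewrite addr0 => ->.
rewrite [X in _ + X](_ : _ = 0) ?addr0 //.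
rewrite /contraction dderiv_0 scaler0 add0r big1 // => l _; by rewrite mxE scale0r.
Qed.

Lemma linmulZ x c k I : linmul x (fun J => c *: k J) I = c *: linmul x k I.
Proof. by rewrite /linmul -scalerAr !scalerA mulrC. Qed.

(** Here and in [cform_wedge], multiplication on superpolynomials becomes the product with a
    1-cochain, expanded over the argument which that 1-cochain takes. The sign is that of moving
    this argument to the front. *)
Lemma cform_linmul x k ks s : homogeneous (L := L) ks s ->
  cform (linmul x k) s =
    \sum_(j < size s) (-1) ^+ (j + sumn (take j ks)) * pair_row x (s`_j).1 *
      cform k (take j s ++ drop j.+1 s).
Proof.
elim: s ks k => [|u s IH] [|d ks] k h; try by case: h.
  by rewrite big_ord0 /= /linmul mcoeffZ linform_mcoeff0 mulr0.
have [hu hs] := (homogeneous_cons _ _ _ _).1 h.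
have E : contraction u (linmul x k) = fun I =>
    pair_row x u.1 *: k I + - ((-1) ^+ d *: linmul x (contraction u k) I).
  apply/funext => I; rewrite contraction_linmul (hom_twist hu); congr (_ + _).
  rewrite -[RHS]scaleNr -linmulZ; congr (linmul _ _ _); apply/funext => J.
  by rewrite contractionN contractionZ scaleNr.
rewrite /= E cformD cformZ cformN cformZ (IH ks) // big_ord_recl /= mul1r drop0.
congr (_ + _); rewrite mulr_sumr -sumrN; apply: eq_bigr => j _ /=.
rewrite -[LHS]mulN1r !mulrA; congr (_ * _ * _).
by rewrite -mulrA -exprD -exprS /bump leq0n addnCA addSn.
Qed.

Lemma cform_wedge l k s :
  cform (wedge l k) s =
    \sum_(j < size s) (-1) ^+ j * (s`_j).2 0 l * cform k (take j s ++ drop j.+1 s).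
Proof.
elim: s k => [|u s IH] k.
  by rewrite big_ord0 /= /wedge in_set0 mcoeff0.
have E : contraction u (wedge l k) = fun I => u.2 0 l *: k I + - wedge l (contraction u k) I.
  by apply/funext => I; rewrite contraction_wedge.
rewrite /= E cformD cformZ cformN IH big_ord_recl /= mul1r drop0.
congr (_ + _); rewrite -sumrN; apply: eq_bigr => j _ /=.
by rewrite exprS mulN1r !mulNr.
Qed.

Lemma cform_br k u v s :
  cform k (ql_br B u v :: s) =
    \sum_l ql_form B l u.1 v.1 * cform (contr l k) s.
Proof.
rewrite /= (_ : contraction _ _ = fun I => \sum_l ql_form B l u.1 v.1 *: contr l k I).
  by rewrite cform_sum; apply: eq_bigr => l _; rewrite cformZ.
apply/funext => I; rewrite /contraction dderiv_0 scaler0 add0r.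
by apply: eq_bigr => l _; rewrite mxE.
Qed.

Variable Q : 'I_r -> S_.
Hypothesis Q_deriv : forall l i, (Q l)^`M(i) = \sum_j B l i j *: 'X_j.

Hypothesis Q_0 : forall l, (Q l)@_0 = 0.

Definition formrow l x : 'rV[F]_m := \row_j \sum_i B l i j * x 0 i.

Lemma dderiv_Q x l : dderiv x (Q l) = linform (formrow l x).
Proof.
rewrite /dderiv /linform.
under eq_bigr => i _ do rewrite Q_deriv scaler_sumr.
rewrite exchange_big; apply: eq_bigr => j _ /=.
rewrite mxE scaler_suml; apply: eq_bigr => i _.
by rewrite scalerA mulrC.
Qed.

Lemma pair_formrow l x y : pair_row (formrow l x) y = ql_form B l x y.
Proof.
rewrite /pair_row /ql_form exchange_big; apply: eq_bigr => j _ /=.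
by rewrite mxE mulr_suml.
Qed.

Lemma contraction_koszul_d u k I :
  contraction u (fun J => - koszul_d Q k J) I =
    - \sum_l linmul (formrow l u.1) (contr l k) I + koszul_d Q (contraction u k) I.
Proof.
have contrN l k1 : contr l (fun J => - k1 J) I = - contr l k1 I.
  by rewrite /contr; case: (l \in I); rewrite ?scalerN ?oppr0.
have contrZ l1 c k1 : contr l1 (fun J => c *: k1 J) I = c *: contr l1 k1 I.
  by rewrite /contr; case: (l1 \in I); rewrite ?scaler0 // !scalerA mulrC.
have contrD l1 k1 k2 : contr l1 (fun J => k1 J + k2 J) I = contr l1 k1 I + contr l1 k2 I.
  by rewrite /contr; case: (l1 \in I); rewrite ?addr0 // scalerDr.
rewrite /contraction /koszul_d.
under [in X in _ + X = _]eq_bigr => l _ do rewrite contrN contr_sum.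
under [in X in _ = _ + X]eq_bigr => l _ do
  rewrite contrD contr_parity contr_map contr_sum mulrDr mulrN -scalerAr.
rewrite linearN (linear_sum (dderiv _)) scalerN scaler_sumr /=.
rewrite [X in _ = _ + X]big_split /= addrA; congr (_ + _).
  rewrite sumrN -opprD; congr (- _); rewrite -big_split; apply: eq_bigr => l _ /=.
  by rewrite dderivM scalerDr dderiv_Q.
under eq_bigr => l _ do rewrite scalerN scaler_sumr -sumrN.
rewrite exchange_big; apply: eq_bigr => l _; rewrite mulr_sumr.
apply: eq_bigr => l' _ /=.
by rewrite contr_mul contrZ contr_anticomm mulrN scalerN opprK scalerAr.
Qed.

(** Induction on the list. Contracting the Koszul differential with [u] differentiates [Q l] into
    the linear form of the bracket with [u], which accounts for the bracket terms of [CE_diff_cons];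
    the rest is the differential of the contraction. *)
Lemma CE_cform k ks s : homogeneous (L := L) ks s ->
  CE_diff (L := L) (cform k) ks s = cform (fun I => - koszul_d Q k I) s.
Proof.
elim: s ks k => [|u s IH] [|d ks] k h; try by case: h.
  rewrite /CE_diff big_ord0 /= mcoeffN /koszul_d mcoeff_sum big1 ?oppr0 // => l _.
  by rewrite (rmorphM (@mpoly.mcoeff m F 0%MM)) /= Q_0 mul0r.
have [hu hs] := (homogeneous_cons _ _ _ _).1 h.
rewrite CE_diff_cons //; last exact: cform_cochain.
rewrite (IH ks (contraction u k)) //= cformN opprK.
have -> : contraction u (fun J => - koszul_d Q k J) = fun I =>
    - (\sum_l linmul (formrow l u.1) (contr l k) I) + koszul_d Q (contraction u k) I.
  by apply/funext => I; exact: contraction_koszul_d.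
rewrite cformD cformN cform_sum; congr (- _ + _).
under [RHS]eq_bigr => l _ do rewrite (cform_linmul _ _ hs).
rewrite exchange_big; apply: eq_bigr => j _.
rewrite [X in _ * X](cform_br k u) mulr_sumr; apply: eq_bigr => l _.
rewrite mulrA pair_formrow; congr (_ * _).
(* The two signs agree when the argument has degree 1; in any other degree it has no odd part and
   the form vanishes. *)
have hj : ql_hom (nth 0%N ks j) s`_j by case: hs => _; apply.
case: (eqVneq (nth 0%N ks j) 1%N) => [->|/eqP nj]; first by rewrite mul1n.
by rewrite (ql_hom1 hj nj) ql_form_sym // ql_form0 !mulr0.
Qed.
End FormCochains.

(** * Cohomology *)

Section Cohomology.
Variables (F : numFieldType) (m r : nat) (B : 'I_r -> 'M[F]_m).
Hypothesis B_sym : forall l i j, B l i j = B l j i.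
Local Notation S_ := (mpoly.mpoly m F).
Local Notation superpoly := ({set 'I_r} -> S_).
Local Notation Lsort := ('rV[F]_m * 'rV[F]_r)%type.
Local Notation L := (qlie B_sym).
Implicit Types (k : superpoly) (I : {set 'I_r}) (l : 'I_r) (p q : S_).
Implicit Types (x y : 'rV[F]_m) (u v : Lsort) (s : seq Lsort).

Definition scal p : superpoly := fun I => if I == set0 then p else 0.

Lemma contr_scal l p I : contr l (scal p) I = 0.
Proof.
rewrite /contr /scal; case: (boolP (l \in I)) => lI //.
have -> : (l |: I == set0) = false by apply/set0Pn; exists l; rewrite setU11.
by rewrite scaler0.
Qed.

Lemma contraction_scal u p : contraction u (scal p) = scal (dderiv u.1 p).
Proof.
apply/funext => I; rewrite /contraction big1 => [|l _]; last by rewrite contr_scal scaler0.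
rewrite addr0 /scal; have [->|_] := eqVneq I set0.
  by rewrite /parity cards0 scale1r.
by rewrite linear0 scaler0.
Qed.

Lemma scal_linear c p q : scal (c *: p + q) = fun I => c *: scal p I + scal q I.
Proof.
by apply/funext => I; rewrite /scal; case: (I == set0); rewrite // scaler0 addr0.
Qed.

Lemma scalB p q : scal (p - q) = fun I => scal p I - scal q I.
Proof. by apply/funext => I; rewrite /scal; case: (I == set0); rewrite // subr0. Qed.

Lemma cform_scalC c s : cform (scal c%:MP) s = if size s == 0%N then c else 0.
Proof.
case: s => [|u s] /=; first by rewrite /scal eqxx mcoeffC eqxx mulr1.
rewrite contraction_scal (_ : dderiv _ _ = 0).
  by rewrite -(cform0 s); congr cform; apply/funext => I; rewrite /scal; case: (I == set0).
by rewrite /dderiv big1 // => i _; rewrite mderivC scaler0.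
Qed.

Lemma cform_scalX i q s :
  cform (scal ('X_i * q)) s =
  \sum_(j < size s) (s`_j).1 0 i * cform (scal q) (take j s ++ drop j.+1 s).
Proof.
elim: s q => [|u s IH] q.
  by rewrite big_ord0 /= /scal eqxx mcoeffXM lep1mP mnm0E.
rewrite [LHS]/= contraction_scal dderivM dderivX mul_mpolyC scal_linear cform_linear IH.
rewrite big_ord_recl /= drop0; congr (_ + _); apply: eq_bigr => j _.
by rewrite /= contraction_scal.
Qed.

Definition odd_coord (i : 'I_m) (u : L) : F := (u : Lsort).1 0 i.

Lemma cup_forms_scal (w : seq 'I_m) (s : seq L) :
  cup_forms odd_coord w s = cform (scal (\prod_(i <- w) 'X_i)) s.
Proof.
elim: w s => [|i w IH] s /=; first by rewrite big_nil cform_scalC -size_eq0; case: (_ == _).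
by rewrite big_cons cform_scalX; apply: eq_bigr => j _; rewrite IH.
Qed.

Definition odd_base (j : 'I_m) : L := (delta_mx 0 j, 0) : Lsort.
Definition even_base l : L := (0, delta_mx 0 l) : Lsort.

Lemma odd_coord_dual : dual_forms odd_base odd_coord.
Proof.
split=> [i a u v|i j|i d u hu nd]; first by rewrite /odd_coord !mxE.
  by rewrite /odd_coord mxE eqxx.
by rewrite /odd_coord (ql_hom1 hu nd) mxE.
Qed.

Definition cform_vanishes k := forall ks s, homogeneous (L := L) ks s -> cform k s = 0.

Lemma cform_odd k s :
  cform k [seq (u.1, 0) | u <- s] = cform (scal (k set0)) s.
Proof.
elim: s k => [|u s IH] k /=; first by rewrite /scal eqxx.
rewrite IH contraction_scal; congr (cform (scal _) _).
rewrite /contraction /parity cards0 scale1r big1 ?addr0 // => l _.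
by rewrite mxE scale0r.
Qed.

Lemma dderiv_delta i p : dderiv (delta_mx 0 i) p = p^`M(i).
Proof.
rewrite /dderiv (bigD1 i) //= big1 => [|j ji]; first by rewrite mxE !eqxx scale1r addr0.
by rewrite mxE eqxx /= (negPf ji) scale0r.
Qed.

(** Odd basis vectors as arguments are partial derivatives, so they recover each coefficient up to a
    product of positive integers. *)
Lemma scal_inj p : cform_vanishes (scal p) -> p = 0.
Proof.
move=> h; apply/mpolyP => al; rewrite mcoeff0.
have [N] := ubnP (mdeg al); elim: N al p h => // N IH al p h hN.
have [->|] := eqVneq al 0%MM; first by have := h [::] [::]; rewrite /= /scal eqxx; apply.
rewrite -mdeg_eq0 => nz.
have [i ali] : exists i, al i != 0%N.
  apply/existsP; apply: contraR nz => /existsPn nz.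
  by rewrite mdegE big1 // => i _; apply/eqP; rewrite -[_ == _]negbK nz.
have le : (U_(i) <= al)%MM by rewrite lep1mP.
have := IH (al - U_(i))%MM p^`M(i); rewrite mcoeff_mderiv submK // => e.
have /eqP : p@_al *+ ((al - U_(i))%MM i).+1 = 0.
  apply: e.
    move=> ks s hs; have := h (1%N :: ks) (odd_base i :: s).
    rewrite /= contraction_scal dderiv_delta; apply.
    by apply/homogeneous_cons.
  by rewrite -ltnS (leq_trans _ hN) // ltnS -{2}(submK le) mdegD mdeg1 addn1.
by rewrite -mulr_natr mulf_eq0 pnatr_eq0 orbF => /eqP.
Qed.

Lemma contraction_even_base l k : contraction (even_base l : Lsort) k = contr l k.
Proof.
apply/funext => I; rewrite /contraction dderiv_0 scaler0 add0r (bigD1 l) //= big1 => [|j jl].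
  by rewrite mxE !eqxx scale1r addr0.
by rewrite mxE eqxx /= (negPf jl) scale0r.
Qed.

(** Even basis vectors as arguments strip the elements off [I]. At [set0], replacing all arguments
    by their odd parts isolates the polynomial component, and [scal_inj] applies. *)
Lemma cform_inj k : cform_vanishes k -> forall I, k I = 0.
Proof.
move=> h I; have [N] := ubnP #|I|; elim: N I k h => // N IH I k h hN.
have [->|/set0Pn[l lI]] := eqVneq I set0.
  apply: scal_inj => ks s hs; rewrite -cform_odd.
  apply: (h (nseq (size s) 1%N)); split; first by rewrite size_nseq size_map.
  move=> i; rewrite size_map => hi.
  by rewrite nth_nseq hi (nth_map 0).
have : contr l k (I :\ l) = 0.
  apply: IH; last by rewrite (cardsD1 l) lI add1n ltnS in hN.
  move=> ks s hs; rewrite -contraction_even_base.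
  by apply: (h (2 :: ks) (even_base l :: s)); apply/homogeneous_cons.
rewrite /contr setD11 setD1K // => /eqP; rewrite scaler_eq0 => /orP[|/eqP //].
by rewrite /esign prodf_seq_eq0 => /hasP[j _ /=]; rewrite signr_eq0 andbF.
Qed.

Lemma row_sum_base n (f : 'rV[F]_n -> F) (y : 'rV[F]_n) :
  (forall c (y z : 'rV[F]_n), f (c *: y + z) = c * f y + f z) ->
  f y = \sum_i y 0 i * f (delta_mx 0 i).
Proof.
move=> h; have f0 : f 0 = 0.
  by have := h (-1) 0 0; rewrite scaler0 addr0 mulN1r addNr.
have fZ c z : f (c *: z) = c * f z by have := h c z 0; rewrite !addr0 f0 addr0.
have fD z z' : f (z + z') = f z + f z' by have := h 1 z z'; rewrite scale1r mul1r.
rewrite {1}[y]row_sum_delta (big_morph f fD f0).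
by apply: eq_bigr => i _; rewrite fZ.
Qed.

Lemma pair_row_delta i x : pair_row (delta_mx 0 i) x = x 0 i.
Proof.
rewrite /pair_row (bigD1 i) //= big1 => [|j ji]; first by rewrite mxE !eqxx mul1r addr0.
by rewrite mxE eqxx /= (negPf ji) mul0r.
Qed.

(** Euler's formula: a form in N + 1 arguments is 1 / (N + 1) times the sum, over a basis, of the
    dual coordinate times the form contracted with the basis vector. Each argument position
    reproduces [om s] once. *)
Lemma cform_surj_size N om : cochain (L := L) om ->
  exists k, forall ks s, homogeneous (L := L) ks s ->
    cform k s = if size s == N then om s else 0.
Proof.
elim: N om => [|N IH] om hom.
  exists (scal (om [::])%:MP) => ks s _; rewrite cform_scalC.
  by case: s.
have /choice[K hK] := fun i => IH _ (cochain_cons (odd_base i) hom).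
have /choice[K' hK'] := fun l => IH _ (cochain_cons (even_base l) hom).
exists (fun I => N.+1%:R^-1 *: (\sum_i linmul (delta_mx 0 i) (K i) I + \sum_l wedge l (K' l) I)).
move=> ks s hs; rewrite cformZ cformD !cform_sum.
under eq_bigr => i _ do rewrite (cform_linmul _ _ hs).
under [X in _ + X]eq_bigr => l _ do rewrite cform_wedge.
rewrite exchange_big [X in _ + X]exchange_big -big_split /=.
have [hsz|hsz] := eqVneq (size s) N.+1; last first.
  rewrite big1 ?mulr0 // => j _; have hj := homogeneous_remove j hs.
  have nsz : (size (take j s ++ drop j.+1 s) == N) = false.
    by apply/negbTE; apply: contra hsz => /eqP <-; rewrite -size_remove.
  rewrite !big1 ?addr0 // => i _; [rewrite (hK' _ _ _ hj)|rewrite (hK _ _ _ hj)];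
  by rewrite nsz mulr0.
rewrite (eq_bigr (fun=> om s)) => [|j _].
  by rewrite sumr_const card_ord hsz -[X in _ * X]mulr_natl mulKf // pnatr_eq0.
have hj := homogeneous_remove j hs.
have szj : size (take j s ++ drop j.+1 s) == N.
  by rewrite -eqSS -size_remove // hsz.
have hdeg : ql_hom (nth 0%N ks j) s`_j by case: hs => _; apply.
have hmove := cochain_move hom hs (ltn_ord j).
set rest := take j s ++ drop j.+1 s in hj szj hmove *.
under eq_bigr => i _ do rewrite (hK _ _ _ hj) szj pair_row_delta -mulrA.
under [X in _ + X]eq_bigr => l _ do rewrite (hK' _ _ _ hj) szj -mulrA.
case: (hom) => om_lin _ _.
rewrite -!mulr_sumr.
rewrite -(@row_sum_base m (fun y => om (((y, 0) : Lsort) :: rest)) (s`_j).1); last first.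
  by move=> c y' z; rewrite -(om_lin [::]) /=; congr (om (_ :: _)); congr (_, _); rewrite /= scaler0 addr0.
rewrite -(@row_sum_base r (fun z : 'rV[F]_r => om (((0, z) : Lsort) :: rest)) (s`_j).2); last first.
  by move=> c y' z; rewrite -(om_lin [::]) /=; congr (om (_ :: _)); congr (_, _); rewrite /= scaler0 addr0.
have om0 : om ((0 : Lsort) :: rest) = 0 by exact: (@cochain0 _ L om [::]).
have signK d (c : F) : (-1) ^+ d * ((-1) ^+ d * c) = c.
  by rewrite mulrA -expr2 sqrr_sign mul1r.
have sE := surjective_pairing (s`_j : Lsort).
have [e1|/eqP n1] := eqVneq (nth 0%N ks j) 1%N.
  have e2 : (s`_j).2 = 0 by move: hdeg; rewrite e1.
  rewrite e2 om0 mulr0 addr0; move: hmove; rewrite e1 mul1n => hmove.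
  by rewrite -[X in om (X :: _)](_ : s`_j = _) ?hmove ?signK // sE e2.
have h1 := ql_hom1 hdeg n1; rewrite h1 om0 mulr0 add0r.
have [e2|/eqP n2] := eqVneq (nth 0%N ks j) 2.
  rewrite -[X in om (X :: _)](_ : s`_j = _) ?hmove; last by rewrite sE h1.
  rewrite e2 -[X in _ * (X * _)]signr_odd oddD oddM /= addbF signr_odd.
  exact: signK.
(* Outside degrees 1 and 2 the argument is 0, so [om s] vanishes as well. *)
have s0 : s`_j = 0 by rewrite sE h1 (ql_hom2 hdeg n2).
rewrite (ql_hom2 hdeg n2) om0 mulr0.
have := signK (j + nth 0 ks j * sumn (take j ks))%N (om s); rewrite -hmove s0 => <-.
by rewrite [om _]om0 mulr0.
Qed.

Lemma cform_surj om : cochain (L := L) om ->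
  exists k, forall ks s, homogeneous (L := L) ks s -> cform k s = om s.
Proof.
move=> hom; case: (hom) => _ _ [n hn].
have /choice[K hK] := fun N => cform_surj_size N hom.
exists (fun I => \sum_(N <- iota 0 n.+1) K N I) => ks s hs.
rewrite cform_sum; under eq_bigr => N _ do rewrite (hK _ _ _ hs).
have [sn|sn] := leqP (size s) n.
  rewrite (bigD1_seq (size s)) ?iota_uniq ?mem_iota //= eqxx big1 ?addr0 // => N.
  by rewrite eq_sym => /negPf ->.
by rewrite hn // big1 // => N _; case: (_ == _).
Qed.

Variable Q : 'I_r -> S_.
Hypothesis Q_deriv : forall l i, (Q l)^`M(i) = \sum_j B l i j *: 'X_j.
Hypothesis Q_0 : forall l, (Q l)@_0 = 0.
Hypothesis Q_exact : forall k, (forall I, koszul_d Q k I = 0) -> k set0 = 0 ->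
  exists k', forall I, k I = koszul_d Q k' I.

Lemma coboundary_cform k k' om :
  (forall I, k I = koszul_d Q k' I) ->
  (forall ks s, homogeneous (L := L) ks s -> om s = cform k s) ->
  coboundary (L := L) om.
Proof.
move=> hk hom; exists (cform (fun I => - k' I)); split; first exact: cform_cochain.
move=> ks s hs; rewrite (CE_cform Q_deriv Q_0) // (hom _ _ hs); congr cform.
apply/funext => I; rewrite hk -[LHS]opprK; congr (- _).
have := koszul_d_linear Q (-1) k' (fun=> 0) I; rewrite koszul_d0 addr0 scaleN1r => <-.
by congr (koszul_d Q _ I); apply/funext => J; rewrite scaleN1r addr0.
Qed.

Lemma koszul_d_scal p I : koszul_d Q (scal p) I = 0.
Proof. by rewrite /koszul_d big1 // => l _; rewrite contr_scal mulr0. Qed.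

Lemma koszul_d_set0 k : koszul_d Q k set0 = \sum_l k [set l] * Q l.
Proof.
apply: eq_bigr => l _; rewrite /contr in_set0 setU0 /esign big_set0 scale1r.
exact: mulrC.
Qed.

Lemma scal_boundary (c : 'I_r -> S_) :
  exists k', forall I, scal (\sum_l c l * Q l) I = koszul_d Q k' I.
Proof.
exists (fun I => if #|I| == 1%N then \sum_(l in I) c l else 0) => I.
rewrite /scal; have [->|/set0Pn[l lI]] := eqVneq I set0.
  by rewrite koszul_d_set0; apply: eq_bigr => l _; rewrite cards1 eqxx big_set1.
rewrite /koszul_d big1 // => l' _; rewrite /contr.
case: (boolP (l' \in I)) => l'I; first by rewrite mulr0.
rewrite cardsU1 l'I (cardsD1 l) lI /= scaler0 mulr0 //.
Qed.

Variables (A : comAlgType F) (pi : {lrmorphism S_ -> A}).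
Hypothesis pi_surj : forall a, exists p, a = pi p.
Hypothesis pi_ker : forall p, pi p = 0 <-> exists c : 'I_r -> S_, p = \sum_l c l * Q l.

Lemma pi_ker_coboundary p om : pi p = 0 ->
  (forall ks s, homogeneous (L := L) ks s -> om s = cform (scal p) s) ->
  coboundary (L := L) om.
Proof.
move=> /pi_ker[c ->]; have [k' hk'] := scal_boundary c.
exact: coboundary_cform hk'.
Qed.

Theorem quadratic_cohomology : cohomology_is (fun i => pi 'X_i) odd_base.
Proof.
(* An arbitrary section of [pi]: linearity and multiplicativity hold only modulo the kernel of [pi],
   that is, up to coboundaries by [pi_ker_coboundary]. *)
have /choice[sec secE] := pi_surj.
exists odd_coord, (fun a => cform (scal (sec a))); split.
- exact: odd_coord_dual.
- move=> a; split; first exact: cform_cochain.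
  move=> ks s hs; rewrite (CE_cform Q_deriv Q_0) // -(cform0 s); congr cform.
  by apply/funext => I; rewrite koszul_d_scal oppr0.
- move=> c a b; apply: (@pi_ker_coboundary (sec (c *: a + b) - (c *: sec a + sec b))).
    by rewrite linearB linearP /= -!secE subrr.
  by move=> ks s _; rewrite scalB cformD cformN scal_linear cform_linear.
- move=> w; apply: (@pi_ker_coboundary (sec (\prod_(i <- w) pi 'X_i) - \prod_(i <- w) 'X_i)).
    by rewrite linearB /= rmorph_prod -secE subrr.
  by move=> ks s _; rewrite scalB cformD cformN cup_forms_scal.
split=> [a [eta [heta ha]]|om [hom dom]].
  (* The primitive is itself of the form [cform k']; the components at [set0] then exhibit [sec a]
     as an element of the ideal. *)
  have [k' hk'] := cform_surj heta.
  have h I : scal (sec a) I + koszul_d Q k' I = 0.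
    apply: (@cform_inj (fun I => scal (sec a) I + koszul_d Q k' I)) => ks s hs.
    rewrite cformD (ha ks) // -(@CE_diff_ext _ L (cform k') eta ks s hk' hs) (CE_cform Q_deriv Q_0) //.
    by rewrite cformN addNr.
  rewrite [a]secE; apply/pi_ker; exists (fun l => - k' [set l]).
  have := h set0; rewrite {1}/scal eqxx koszul_d_set0 => /eqP; rewrite addr_eq0 => /eqP ->.
  by rewrite -sumrN; apply: eq_bigr => l _; rewrite mulNr.
have [k hk] := cform_surj hom.
have dk I : koszul_d Q k I = 0.
  apply/eqP; rewrite -oppr_eq0; apply/eqP.
  apply: (@cform_inj (fun I => - koszul_d Q k I)) => ks s hs.
  by rewrite -(CE_cform Q_deriv Q_0 _ hs) (@CE_diff_ext _ L (cform k) om ks s hk hs) dom.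
(* The component of exterior degree 0 is always a cycle, so the remainder is one too, and exactness
   makes it a boundary. *)
have [k' hk'] : exists k', forall I, k I - scal (k set0) I = koszul_d Q k' I.
  apply: Q_exact => [I|]; first by rewrite koszul_dB dk koszul_d_scal subr0.
  by rewrite /scal eqxx subrr.
exists (pi (k set0)).
have [c hc] : exists c : 'I_r -> S_, k set0 - sec (pi (k set0)) = \sum_l c l * Q l.
  by apply/pi_ker; rewrite linearB /= -secE subrr.
have [k2 hk2] := scal_boundary c.
apply: (@coboundary_cform (fun I => k I - scal (sec (pi (k set0))) I) (fun I => k' I + k2 I)).
  move=> I; rewrite koszul_dD -hk' -hk2 -hc scalB.
  by rewrite addrA subrK.
by move=> ks s hs; rewrite cformD cformN (hk ks).
Qed.
End Cohomology.

(** * The dual algebra *)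

Section MatrixPairing.
Variables (F : numFieldType) (m : nat) (V : lmodType F) (g : 'I_m -> 'I_m -> V).

Definition mxpair (c : 'M[F]_m) : V := \sum_i \sum_j c i j *: g i j.

Lemma mxpair_linear : linear mxpair.
Proof.
move=> a c d; rewrite /mxpair scaler_sumr -big_split; apply: eq_bigr => i _ /=.
rewrite scaler_sumr -big_split; apply: eq_bigr => j _ /=.
by rewrite !mxE scalerDl scalerA.
Qed.
HB.instance Definition _ := GRing.isLinear.Build F 'M[F]_m V _ mxpair mxpair_linear.

Lemma mxpair_delta i j : mxpair (delta_mx i j) = g i j.
Proof.
rewrite /mxpair (bigD1 i) //= [X in _ + X]big1 => [|i' h]; last first.
  by rewrite big1 // => j' _; rewrite mxE (negPf h) scale0r.
rewrite addr0 (bigD1 j) //= big1 => [|j' h]; first by rewrite mxE !eqxx scale1r addr0.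
by rewrite mxE (negPf h) andbF scale0r.
Qed.
End MatrixPairing.

Lemma row_sum_delta_coef (F : numFieldType) m n (c : 'I_m -> F) (g : 'I_m -> 'I_n) i :
  injective g -> (\sum_j c j *: delta_mx 0 (g j) : 'rV[F]_n) 0 (g i) = c i.
Proof.
move=> ginj; rewrite summxE (bigD1 i) //= big1 => [|j h]; first by rewrite !mxE !eqxx mulr1 addr0.
by rewrite !mxE (inj_eq ginj) eq_sym (negPf h) mulr0.
Qed.

Section KoszulDuality.
Variables (F : numFieldType) (m r : nat) (C : 'I_r -> 'M[F]_m).
Local Notation S_ := (mpoly.mpoly m F).
Local Notation Lsort := ('rV[F]_m * 'rV[F]_r)%type.

Definition qform l : S_ := \sum_i \sum_j C l i j *: ('X_i * 'X_j).
(** The Hessian of [qform l]; as bracket form it satisfies the hypothesis [Q_deriv] of the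
    comparison of differentials. *)
Definition qmx l : 'M[F]_m := C l + (C l)^T.

Lemma qmxE l i j : qmx l i j = C l i j + C l j i.
Proof. by rewrite !mxE. Qed.

Lemma qmx_sym l i j : qmx l i j = qmx l j i.
Proof. by rewrite !qmxE addrC. Qed.

Lemma mcoeff0M (p q : S_) : (p * q)@_0 = p@_0 * q@_0.
Proof. exact: (rmorphM (@mpoly.mcoeff m F 0%MM)). Qed.

Lemma mcoeff0X i : ('X_i : S_)@_0 = 0.
Proof. by rewrite mcoeffX mnm1_eq0. Qed.

Lemma qform_mcoeff0 l : (qform l)@_0 = 0.
Proof.
rewrite /qform mcoeff_sum big1 // => i _; rewrite mcoeff_sum big1 // => j _.
by rewrite mcoeffZ mcoeff0M mcoeff0X mul0r mulr0.
Qed.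

Lemma quad_deriv (c : 'M[F]_m) k :
  (\sum_i \sum_j c i j *: ('X_i * 'X_j : S_))^`M(k) = \sum_j (c k j + c j k) *: 'X_j.
Proof.
have E i j : (c i j *: ('X_i * 'X_j : S_))^`M(k) =
    (c i j * (i == k)%:R) *: 'X_j + (c i j * (j == k)%:R) *: 'X_i.
  rewrite mderivZ mderivM !mderiv_X !mul_mpolyC [_ * _%:MP]mulrC mul_mpolyC.
  by rewrite scalerDr !scalerA.
rewrite (linear_sum (mderiv k)).
under eq_bigr => i _ do rewrite (linear_sum (mderiv k)) /=.
under eq_bigr => i _ do under eq_bigr => j _ do rewrite E.
under eq_bigr => i _ do rewrite big_split.
rewrite big_split /=; under [RHS]eq_bigr => j _ do rewrite scalerDl.
rewrite big_split /=; congr (_ + _).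
  rewrite (bigD1 k) //= [X in _ + X]big1 => [|i ik].
    by rewrite addr0; apply: eq_bigr => j _; rewrite eqxx mulr1.
  by rewrite big1 // => j _; rewrite (negPf ik) mulr0 scale0r.
apply: eq_bigr => i _; rewrite (bigD1 k) //= big1 => [|j jk].
  by rewrite eqxx mulr1 addr0.
by rewrite (negPf jk) mulr0 scale0r.
Qed.

Lemma qform_deriv l i : (qform l)^`M(i) = \sum_j qmx l i j *: 'X_j.
Proof. by rewrite quad_deriv; apply: eq_bigr => j _; rewrite qmxE. Qed.

Lemma linear_deriv0 (c : 'I_m -> F) j :
  ((\sum_i c i *: 'X_i : S_)^`M(j))@_0 = c j.
Proof.
rewrite (linear_sum (mderiv j)) mcoeff_sum (bigD1 j) //= big1 => [|i ij].
  by rewrite addr0 mderivZ mderiv_X eqxx mcoeffZ mcoeffC eqxx !mulr1.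
by rewrite mderivZ mderiv_X (negPf ij) mcoeffZ mcoeffC mul0r mulr0.
Qed.

Lemma linear_mcoeff0 (c : 'I_m -> F) : (\sum_i c i *: 'X_i : S_)@_0 = 0.
Proof. by rewrite mcoeff_sum big1 // => i _; rewrite mcoeffZ mcoeff0X mulr0. Qed.

Variables (A : comAlgType F) (pi : {lrmorphism S_ -> A}).
Hypothesis pi_ker : forall p, pi p = 0 <-> exists c : 'I_r -> S_, p = \sum_l c l * qform l.

Let x i := pi 'X_i.

Lemma quad_relE (c : 'M[F]_m) :
  quad_rel x c <-> pi (\sum_i \sum_j c i j *: ('X_i * 'X_j)) = 0.
Proof.
rewrite /quad_rel [pi _](_ : _ = \sum_i \sum_j c i j *: (x i * x j)) //.
rewrite linear_sum; apply: eq_bigr => i _; rewrite linear_sum; apply: eq_bigr => j _ /=.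
by rewrite linearZ rmorphM.
Qed.

(** Take second derivatives at 0 of an expression of the relation in the ideal: the quadrics vanish
    to second order, so only the constant terms of their multipliers survive. *)
Lemma quad_rel_sym (c : 'M[F]_m) : quad_rel x c ->
  exists a : 'I_r -> F, forall i j, c i j + c j i = \sum_l a l * qmx l i j.
Proof.
move/quad_relE/pi_ker => [p hp]; exists (fun l => (p l)@_0) => i j.
have := congr1 (fun q : S_ => (q^`M(i)^`M(j))@_0) hp.
rewrite quad_deriv linear_deriv0 => ->.
rewrite (linear_sum (mderiv i)) (linear_sum (mderiv j)) mcoeff_sum.
apply: eq_bigr => l _; rewrite /= mderivM mderivD !mderivM !mcoeffD !mcoeff0M.
by rewrite qform_mcoeff0 !qform_deriv linear_deriv0 !linear_mcoeff0 !mulr0 !add0r.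
Qed.

Lemma quad_rel_C l : quad_rel x (C l).
Proof.
apply/quad_relE/pi_ker; exists (fun l' => (l' == l)%:R).
rewrite (bigD1 l) //= eqxx mul1r [X in _ + X]big1 ?addr0 // => l' /negPf ->.
exact: mul0r.
Qed.

Lemma quad_rel_comm i j : quad_rel x (delta_mx i j - delta_mx j i).
Proof.
rewrite /quad_rel -/(mxpair (fun i j => x i * x j) _) linearB /= !mxpair_delta.
by rewrite mulrC subrr.
Qed.

Lemma perp_sym c i j : quad_rel_perp x c -> c i j = c j i.
Proof.
move=> /(_ _ (quad_rel_comm i j)).
under eq_bigr => i' _ do under eq_bigr => j' _ do rewrite mulrC.
rewrite -/(@mxpair F m F^o (fun i j => c i j) _) linearB /= !mxpair_delta.
by move/eqP; rewrite subr_eq0 => /eqP.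
Qed.

Variables (a b : 'I_r -> 'I_m).
Hypothesis lead_qmx : forall l l', qmx l' (a l) (b l) = (l' == l)%:R.
Hypothesis central_pair : forall l k, exists i j,
  [/\ forall l', qmx l' i j = (l' == l)%:R, forall l', qmx l' k i = 0
    & forall l', qmx l' k j = 0].

Local Notation L := (qlie qmx_sym).
Local Notation odd_base := (@odd_base F m r qmx qmx_sym).
Local Notation even_base := (@even_base F m r qmx qmx_sym).

Lemma ql_br_base i j : lie_br (odd_base i) (odd_base j) = ((0, \row_l qmx l i j) : Lsort).
Proof.
congr (_, _); apply/rowP => l; rewrite !mxE /ql_form (bigD1 i) //= [X in _ + X]big1 => [|i' h].
  rewrite addr0 (bigD1 j) //= big1 => [|j' h]; first by rewrite !mxE !eqxx !mulr1 addr0.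
  by rewrite [X in _ * X]mxE (negPf h) andbF mulr0.
by rewrite big1 // => j' _; rewrite [X in _ * X * _]mxE (negPf h) andbF mulr0 mul0r.
Qed.

Lemma br_lead l : lie_br (odd_base (a l)) (odd_base (b l)) = even_base l.
Proof.
rewrite ql_br_base; congr (_, _); apply/rowP => l'.
by rewrite mxE lead_qmx mxE eqxx.
Qed.

Lemma qlie_decomp (u : L) :
  u = \sum_i (u : Lsort).1 0 i *: odd_base i + \sum_l (u : Lsort).2 0 l *: even_base l.
Proof.
have s1 (T : finType) (f : T -> Lsort) : (\sum_t f t).1 = \sum_t (f t).1.
  exact: (big_morph (fun z : Lsort => z.1)).
have s2 (T : finType) (f : T -> Lsort) : (\sum_t f t).2 = \sum_t (f t).2.
  exact: (big_morph (fun z : Lsort => z.2)).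
rewrite [LHS](surjective_pairing (u : Lsort)) [RHS](surjective_pairing (_ : Lsort)).
congr (_, _); rewrite /= !(s1, s2) /=.
  by rewrite [X in _ = _ + X]big1 ?addr0 => [|l _]; rewrite ?scaler0 // -row_sum_delta.
by rewrite [X in _ = X + _]big1 ?add0r => [|l _]; rewrite ?scaler0 // -row_sum_delta.
Qed.

Lemma br_base_sum i j :
  lie_br (odd_base i) (odd_base j) = \sum_l qmx l i j *: even_base l.
Proof.
rewrite ql_br_base [LHS]qlie_decomp /= big1 ?add0r => [|k _]; last by rewrite mxE scale0r.
by apply: eq_bigr => l _; rewrite mxE.
Qed.

Lemma odd_base_basis : is_basis (lie_hom (l := L) 1%N) odd_base.
Proof.
split=> [v|c h i].
  split=> [hv|[c ->]].
    exists ((v : Lsort).1 0); rewrite {1}[v]qlie_decomp hv [X in _ + X]big1 ?addr0 // => l _.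
    by rewrite mxE scale0r.
  rewrite /= (big_morph (fun z : Lsort => z.2) (id1 := 0) (op1 := +%R)) // big1 // => i _.
  by rewrite /= scaler0.
have := congr1 (fun u : L => (u : Lsort).1 0 i) h.
rewrite (big_morph (fun z : Lsort => z.1) (id1 := 0) (op1 := +%R)) //= (@row_sum_delta_coef _ _ _ c id) ?mxE => [->|] //; exact: inj_id.
Qed.

Lemma qlie_generated : lie_generated_by (lie_hom (l := L) 1%N).
Proof.
move=> P [P0 PD] Pbr P1 u; rewrite [u]qlie_decomp.
have Padd v w : P v -> P w -> P (v + w) by move=> hv hw; have := PD 1 _ _ hv hw; rewrite scale1r.
have Pscale c v : P v -> P (c *: v) by move=> hv; have := PD c _ _ hv P0; rewrite addr0.
apply: (Padd); (apply: (big_ind P); [exact: P0|exact: Padd|move=> k _; apply: Pscale]); first exact: P1.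
by rewrite -br_lead; apply: Pbr; apply: P1.
Qed.

Section Enveloping.
Variables (U : algType F) (xi : 'I_m -> U).
Hypothesis xi_presents : presents xi (fun t => exists2 c, quad_rel_perp x c & t = quad_tensor c).

Lemma perp_rel c : quad_rel_perp x c -> mxpair (fun i j => xi i * xi j) c = 0.
Proof.
move=> hc; rewrite -[LHS]tensor_eval_quad; apply/(xi_presents.2).
by apply: ideal_gen_base; exists c.
Qed.

Definition central_gen l : U := xi (a l) * xi (b l) + xi (b l) * xi (a l).

Lemma xi_anticomm i j :
  xi i * xi j + xi j * xi i = \sum_l qmx l i j *: central_gen l.
Proof.
(* By [quad_rel_sym] the symmetrised entries of a relation at (i, j) are determined by those at the
   leading positions; this matrix expresses that dependence, so it annihilates all relations. *)
pose c : 'M[F]_m := delta_mx i j + delta_mx j i -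
  \sum_l qmx l i j *: (delta_mx (a l) (b l) + delta_mx (b l) (a l)).
have hc : quad_rel_perp x c.
  move=> d /quad_rel_sym[t ht].
  rewrite -[LHS]/(@mxpair F m F^o (fun i j => d i j) c) /c linearB linearD /= !mxpair_delta ht.
  rewrite [X in _ - X](_ : _ = \sum_l t l * qmx l i j); first exact: subrr.
  rewrite linear_sum; apply: eq_bigr => l _.
  rewrite linearZ linearD /= !mxpair_delta ht (bigD1 l) //= lead_qmx eqxx mulr1 big1 => [|l' h].
    by rewrite addr0; exact: mulrC.
  by rewrite lead_qmx (negPf h) mulr0.
have := perp_rel hc; rewrite /c linearB linearD /= !mxpair_delta => /eqP.
rewrite subr_eq0 => /eqP ->; rewrite linear_sum; apply: eq_bigr => l _.
by rewrite linearZ linearD /= !mxpair_delta.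
Qed.

(** In the representation given by [central_pair] both factors anticommute with [xi k], so their
    products commute with it. *)
Lemma central_genC l k : central_gen l * xi k = xi k * central_gen l.
Proof.
have [i [j [hl hi hj]]] := central_pair l k.
have -> : central_gen l = xi i * xi j + xi j * xi i.
  rewrite xi_anticomm (bigD1 l) //= hl eqxx scale1r big1 ?addr0 // => l' h.
  by rewrite hl (negPf h) scale0r.
have ac t : (forall l', qmx l' k t = 0) -> xi t * xi k = - (xi k * xi t).
  move=> h; apply/eqP; rewrite -addr_eq0 addrC xi_anticomm big1 // => l' _.
  by rewrite h scale0r.
have move_k t t' : (forall l', qmx l' k t = 0) -> (forall l', qmx l' k t' = 0) ->
    xi t * xi t' * xi k = xi k * (xi t * xi t').
  by move=> ht ht'; rewrite -mulrA (ac _ ht') mulrN (mulrA (xi t)) (ac _ ht) mulNr opprK -mulrA.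
by rewrite mulrDl mulrDr !move_k.
Qed.

Lemma central_gen_comm l l' : central_gen l * central_gen l' = central_gen l' * central_gen l.
Proof.
rewrite {2}/central_gen mulrDr !mulrA !central_genC -!(mulrA (xi _)) !central_genC.
by rewrite !mulrA -mulrDl.
Qed.

Definition odd_embed (y : 'rV[F]_m) : U := \sum_i y 0 i *: xi i.
Definition even_embed (y : 'rV[F]_r) : U := \sum_l y 0 l *: central_gen l.
Definition env_embed (u : L) : U := odd_embed (u : Lsort).1 + even_embed (u : Lsort).2.

Lemma env_embed_linear : forall c u v, env_embed (c *: u + v) = c *: env_embed u + env_embed v.
Proof.
move=> c u v; rewrite /env_embed scalerDr addrACA; congr (_ + _).
  rewrite /odd_embed scaler_sumr -big_split; apply: eq_bigr => i _ /=.
  by rewrite !mxE scalerDl scalerA.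
rewrite /even_embed scaler_sumr -big_split; apply: eq_bigr => i _ /=.
by rewrite !mxE scalerDl scalerA.
Qed.

Lemma odd_embed0 : odd_embed 0 = 0.
Proof. by rewrite /odd_embed big1 // => i _; rewrite mxE scale0r. Qed.

Lemma even_embed0 : even_embed 0 = 0.
Proof. by rewrite /even_embed big1 // => i _; rewrite mxE scale0r. Qed.

Lemma env_embed_odd i : env_embed (odd_base i) = xi i.
Proof.
rewrite /env_embed even_embed0 addr0 /odd_embed (bigD1 i) //= big1 => [|j h].
  by rewrite addr0 mxE !eqxx scale1r.
by rewrite mxE (negPf h) scale0r.
Qed.

Lemma odd_embed_anticomm y z :
  odd_embed y * odd_embed z + odd_embed z * odd_embed y =
  even_embed (\row_l ql_form qmx l y z).
Proof.
rewrite /odd_embed mulr_suml [X in _ + X]mulr_sumr -big_split /=.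
under eq_bigr => i _ do rewrite mulr_sumr mulr_suml -big_split /=.
under eq_bigr => i _ do under eq_bigr => j _ do
  rewrite -!scalerAl -!scalerAr !scalerA [z 0 j * _]mulrC -scalerDr xi_anticomm scaler_sumr.
rewrite /even_embed.
under [RHS]eq_bigr => l _ do rewrite mxE scaler_suml.
rewrite [RHS]exchange_big; apply: eq_bigr => i _ /=.
under [RHS]eq_bigr => l _ do rewrite scaler_suml.
rewrite [RHS]exchange_big; apply: eq_bigr => j _ /=; apply: eq_bigr => l _.
by rewrite scalerA; congr (_ *: _); rewrite mulrC mulrA.
Qed.

Lemma even_embed_central y u : even_embed y * env_embed u = env_embed u * even_embed y.
Proof.
rewrite /even_embed mulr_suml mulr_sumr; apply: eq_bigr => l _.
rewrite -scalerAl -scalerAr; congr (_ *: _). rewrite /env_embed mulrDr [RHS]mulrDl; congr (_ + _).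
  rewrite /odd_embed mulr_suml mulr_sumr; apply: eq_bigr => i _.
  by rewrite -scalerAl -scalerAr central_genC.
rewrite /even_embed mulr_suml mulr_sumr; apply: eq_bigr => i _.
by rewrite -scalerAl -scalerAr central_gen_comm.
Qed.

Lemma env_embed_lie : lie_map_to_alg env_embed.
Proof.
split=> [|i j u v hu hv]; first exact: env_embed_linear.
have env0 : env_embed 0 = 0 by rewrite /env_embed odd_embed0 even_embed0 addr0.
have evenE (w : L) : (w : Lsort).1 = 0 -> env_embed w = even_embed (w : Lsort).2.
  by move=> h; rewrite /env_embed h odd_embed0 add0r.
have [ei|/eqP ni] := eqVneq i 1%N; last first.
  have hu1 := ql_hom1 hu ni; rewrite [lie_br u v](ql_br0 _ _ hu1) env0 //.
  have [e2|/eqP n2] := eqVneq i 2.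
    by rewrite e2 exprM sqrrN expr1n expr1n scale1r (evenE u) // even_embed_central subrr.
  have -> : u = 0 by rewrite [u](surjective_pairing (u : Lsort)) hu1 (ql_hom2 hu n2).
  by rewrite env0 mul0r mulr0 scaler0 subr0.
have [ej|/eqP nj] := eqVneq j 1%N; last first.
  have hv1 := ql_hom1 hv nj; rewrite [lie_br u v](ql_br0r _ _ hv1) ?env0 //; last exact: qmx_sym.
  have [e2|/eqP n2] := eqVneq j 2.
    by rewrite e2 mulnC exprM sqrrN expr1n expr1n scale1r (evenE v) // even_embed_central subrr.
  have -> : v = 0 by rewrite [v](surjective_pairing (v : Lsort)) hv1 (ql_hom2 hv n2).
  by rewrite env0 mul0r mulr0 scaler0 subr0.
subst; rewrite expr1 scaleN1r opprK.
have oddE (w : L) : (w : Lsort).2 = 0 -> env_embed w = odd_embed (w : Lsort).1.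
  by move=> h; rewrite /env_embed h even_embed0 addr0.
rewrite (oddE u) // (oddE v) // odd_embed_anticomm.
by rewrite /env_embed odd_embed0 add0r.
Qed.

Lemma env_embed_universal : enveloping_algebra env_embed.
Proof.
split=> [|B' f [flin fbr]]; first exact: env_embed_lie.
have f0 : f 0 = 0.
  by have := flin (-1) 0 0; rewrite scaler0 addr0 scaleN1r addNr.
have fD u v : f (u + v) = f u + f v by have := flin 1 u v; rewrite !scale1r.
have fZ c u : f (c *: u) = c *: f u by have := flin c u 0; rewrite !addr0 f0 addr0.
have fsum (T : finType) (h : T -> L) : f (\sum_t h t) = \sum_t f (h t).
  exact: (big_morph f fD f0).
have fac i j : f (odd_base i) * f (odd_base j) + f (odd_base j) * f (odd_base i) =
    f (lie_br (odd_base i) (odd_base j)).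
  rewrite (fbr 1%N 1%N) //.
  by rewrite expr1 scaleN1r opprK.
have frel t : (exists2 c, quad_rel_perp x c & t = quad_tensor c) ->
    tensor_eval (fun i => f (odd_base i)) t = 0.
  case=> c hc ->; rewrite tensor_eval_quad.
  pose G i j := f (odd_base i) * f (odd_base j).
  rewrite -/(mxpair G c); apply/eqP.
  (* Since [c] is symmetric, doubling turns products into anticommutators, which are images of
     brackets in L; the resulting combination of brackets is 0 because [c] annihilates each
     [C l]. *)
  have two : mxpair G c *+ 2 = mxpair (fun i j => G i j + G j i) c.
    rewrite mulr2n {2}/mxpair exchange_big /mxpair -big_split; apply: eq_bigr => i _ /=.
    rewrite -big_split; apply: eq_bigr => j _ /=.
    by rewrite scalerDr (perp_sym _ _ hc).
  suff : mxpair G c *+ 2 == 0 by rewrite -scaler_nat scaler_eq0 pnatr_eq0.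
  rewrite two /mxpair.
  under eq_bigr => i _ do under eq_bigr => j _ do rewrite /G fac -fZ.
  under eq_bigr => i _ do rewrite -fsum.
  rewrite -fsum (_ : \sum_i _ = 0) ?f0 //.
  have -> : \sum_i \sum_j c i j *: lie_br (odd_base i) (odd_base j) =
      \sum_l (\sum_i \sum_j c i j * qmx l i j) *: even_base l.
    under eq_bigr => i _ do under eq_bigr => j _ do rewrite br_base_sum scaler_sumr.
    under [RHS]eq_bigr => l _ do rewrite scaler_suml.
    rewrite [RHS]exchange_big; apply: eq_bigr => i _.
    under [RHS]eq_bigr => l _ do rewrite scaler_suml.
    rewrite [RHS]exchange_big; apply: eq_bigr => j _.
    by apply: eq_bigr => l _; rewrite scalerA.
  rewrite big1 // => l _; rewrite (_ : \sum_i _ = 0) ?scale0r //.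
  under eq_bigr => i _ do under eq_bigr => j _ do rewrite qmxE mulrDr.
  under eq_bigr => i _ do rewrite big_split.
  rewrite big_split /= (hc _ (quad_rel_C l)) add0r exchange_big -[RHS](hc _ (quad_rel_C l)).
  by apply: eq_bigr => i _; apply: eq_bigr => j _; rewrite (perp_sym _ _ hc).
have [g gE] := presents_lift xi_presents frel.
exists g; split=> [u|g' hg']; last first.
  by apply: (presents_ext xi_presents) => i; rewrite gE -env_embed_odd hg'.
rewrite [u in RHS]qlie_decomp fD !fsum /env_embed /odd_embed /even_embed linearD !linear_sum /=.
congr (_ + _); apply: eq_bigr => k _; rewrite fZ linearZ /= ?gE //.
by rewrite /central_gen linearD /= !rmorphM /= !gE fac br_lead.
Qed.
End Enveloping.

Theorem quadratic_koszul_dual : koszul_dual x odd_base.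
Proof.
split; [exact: odd_base_basis|exact: qlie_generated|].
have [t [c _ ->]|U [xi hxi]] := @presentation_exists F m
  (fun t => exists2 c, quad_rel_perp x c & t = quad_tensor c).
  rewrite tensor_eval_quad big1 // => i _; rewrite big1 // => j _.
  by rewrite mul0r scaler0.
exists U, (env_embed xi); split; first exact: env_embed_universal.
rewrite /quadratic_dual (_ : (fun i => _) = xi) //.
by apply/funext => i; exact: env_embed_odd.
Qed.
End KoszulDuality.

(** * The quadratic algebra *)

Lemma mpoly_Xind (F : numFieldType) m (P : mpoly.mpoly m F -> Prop) :
  P 1 -> (forall a p q, P p -> P q -> P (a *: p + q)) ->
  (forall i p, P p -> P ('X_i * p)) -> forall p, P p.
Proof.
move=> P1 PD PM p.
have P0 : P 0 by have := PD (-1) 1 1 P1 P1; rewrite scaleN1r addNr.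
elim/mpolyind: p => // c al p _ _ Pp; apply: (PD) => //.
have Pexp i e q : P q -> P ('X_i ^+ e * q).
  by move=> Pq; elim: e => [|e IH]; rewrite ?mul1r // exprS -mulrA; apply: PM.
rewrite mpolyXE_id -[\prod_(_ < _) _]mulr1.
elim/big_rec: _ => [|i q _ Pq]; first by rewrite mulr1.
by rewrite -mulrA; apply: Pexp.
Qed.

Section QuadraticAlgebra.
Variables (F : numFieldType) (m r : nat) (C : 'I_r -> 'M[F]_m).
Local Notation S_ := (mpoly.mpoly m F).
Variables (A : comAlgType F) (pi : {lrmorphism S_ -> A}).
Hypothesis pi_surj : forall a, exists p, a = pi p.
Hypothesis pi_ker : forall p, pi p = 0 <-> exists c : 'I_r -> S_, p = \sum_l c l * qform C l.

Let x i := pi 'X_i.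
Definition image_homog (d : nat) (a : A) : Prop :=
  exists2 p : S_, p \is d.-homog & a = pi p.

Lemma qform_homog l : qform C l \is 2.-homog.
Proof.
apply: rpred_sum => i _; apply: rpred_sum => j _; apply: dhomogZ.
by apply: (@dhomogM _ _ _ 1 _ 1); rewrite dhomogX /= mdeg1.
Qed.

(** The witness is the component of [c] of degree d - 2. Selecting it by the test e + 2 = d, instead
    of a truncated subtraction, makes it 0 for d < 2. *)
Lemma pihomog_mul_quad d (c q : S_) : q \is 2.-homog ->
  exists2 c' : S_, pihomog mdeg d (c * q) = c' * q & (d < 2)%N -> c' = 0.
Proof.
move=> hq; have E := @pihomog_partitionE _ _ mdeg (mmeasure mdeg c) c (leqnn _).
exists (\sum_(e < mmeasure mdeg c) if (e + 2 == d)%N then pihomog mdeg e c else 0).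
  rewrite {1}E mulr_suml (linear_sum (pihomog mdeg d)) /= mulr_suml; apply: eq_bigr => e _.
  have h := dhomogM (pihomogP mdeg e c) hq.
  case: eqP => [<-|/eqP ne]; first by rewrite pihomog_dE.
  by rewrite mul0r (pihomog_ne0 ne h).
move=> d2; rewrite big1 // => e _; case: eqP => // h.
by move: d2; rewrite -h addn2.
Qed.

Lemma pi_pihomog d p : pi p = 0 -> pi (pihomog mdeg d p) = 0.
Proof.
move=> /pi_ker[c ->]; apply/pi_ker.
have /choice[c' hc'] : forall l, exists c' : S_, pihomog mdeg d (c l * qform C l) = c' * qform C l.
  by move=> l; have [c' h _] := pihomog_mul_quad d (c l) (qform_homog l); exists c'.
by exists c'; rewrite (linear_sum (pihomog mdeg d)); apply: eq_bigr => l _; exact: hc'.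
Qed.

Lemma pi_low_degree d p : p \is d.-homog -> (d < 2)%N -> pi p = 0 -> p = 0.
Proof.
move=> hp hd /pi_ker[c hc]; rewrite -(pihomog_dE hp) hc (linear_sum (pihomog mdeg d)) big1 // => l _ /=.
have [c' -> /(_ hd) ->] := pihomog_mul_quad d (c l) (qform_homog l).
by rewrite mul0r.
Qed.

Lemma image_homog_graded : graded image_homog.
Proof.
split=> [d|a|n c hc c0 d ltdn].
- split; first by exists 0; rewrite ?linear0 // dhomog0.
  move=> a u v [p hp ->] [q hq ->]; exists (a *: p + q); last by rewrite linearP.
  by apply: dhomogD => //; exact: dhomogZ.
- have [p ->] := pi_surj a.
  exists (mmeasure mdeg p), (fun d => pi (pihomog mdeg d p)); split=> [d|].
    by exists (pihomog mdeg d p) => //; exact: pihomogP.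
  by rewrite {1}(@pihomog_partitionE _ _ mdeg _ p (leqnn _)) linear_sum.
have /choice[p hp] : forall d, exists p : S_, p \is d.-homog /\ c d = pi p.
  by move=> e; have [p h1 h2] := hc e; exists p.
have /(pi_pihomog d) : pi (\sum_(k < n) p k) = 0.
  by rewrite linear_sum -[RHS]c0; apply: eq_bigr => k _; case: (hp k).
rewrite (linear_sum (pihomog mdeg d)) (bigD1 (Ordinal ltdn)) //= [X in pi (_ + X)]big1 => [|k hk].
  by rewrite addr0 pihomog_dE; case: (hp d) => // _ ->.
apply: (@pihomog_ne0 _ _ mdeg k); last by case: (hp k).
by apply: contra hk => /eqP e; apply/eqP/val_inj.
Qed.

Lemma image_homog_algebra : graded_algebra image_homog.
Proof.
split; first exact: image_homog_graded.
  by exists 1; [exact: dhomog1|rewrite rmorph1].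
move=> i j a b [p hp ->] [q hq ->]; exists (p * q); last by rewrite rmorphM.
exact: dhomogM.
Qed.

Lemma image_homog0 a : image_homog 0 a <-> exists c : F, a = c%:A.
Proof.
split=> [[p hp ->]|[c ->]].
  exists p@_0; rewrite -(rmorph1 pi) -linearZ; congr (pi _).
  apply/mpolyP => al; rewrite mcoeffZ mcoeff1.
  have [->|nz] := eqVneq al 0%MM; first by rewrite mulr1.
  by rewrite mulr0 (dhomog_nemf_coeff hp) // mdeg_eq0.
exists (c *: 1); last by rewrite linearZ rmorph1.
by apply: dhomogZ; exact: dhomog1.
Qed.

Lemma image_homog1_basis : is_basis (image_homog 1) x.
Proof.
have homX (c : 'I_m -> F) : \sum_i c i *: 'X_i \is [in F[m], 1.-homog].
  by apply: rpred_sum => i _; apply: dhomogZ; rewrite dhomogX /= mdeg1.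
have piX (c : 'I_m -> F) : pi (\sum_i c i *: 'X_i) = \sum_i c i *: x i.
  by rewrite linear_sum; apply: eq_bigr => i _; rewrite linearZ.
split=> [a|c hc i]; last first.
  have := pi_low_degree (homX c) isT; rewrite piX => /(_ hc) h.
  by rewrite -(linear_deriv0 c i) h mderiv0 mcoeff0.
split=> [[p hp ->]|[c ->]]; last by exists (\sum_i c i *: 'X_i).
exists (fun i => p@_(U_(i))); rewrite -piX; congr (pi _); apply/mpolyP => al.
rewrite mcoeff_sum; under eq_bigr => i _ do rewrite mcoeffZ mcoeffX.
have [/eqP e|ne] := eqVneq (mdeg al) 1%N.
  have [i /eqP ->] := mdeg1P _ e.
  rewrite (bigD1 i) //= eqxx mulr1 big1 ?addr0 // => j h.
  by rewrite eq_mnm1 (negPf h) mulr0.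
rewrite (dhomog_nemf_coeff hp ne) big1 // => i _.
case: eqP => [h|_]; last by rewrite mulr0.
by move: ne; rewrite -h mdeg1.
Qed.

Lemma tensor_eval_X_surj (p : S_) :
  exists t : tensor_alg F m, p = tensor_eval (fun i => 'X_i : S_) t.
Proof.
elim/mpoly_Xind: p => [|a p q [t ->] [t' ->]|i p [t ->]].
- by exists 1; rewrite rmorph1.
- by exists (a *: t + t'); rewrite linearP.
by exists (<< fmu i >> * t); rewrite rmorphM /= tensor_evalU.
Qed.

Lemma pi_tensor_eval t : pi (tensor_eval (fun i => 'X_i : S_) t) = tensor_eval x t.
Proof. exact: lrmorph_tensor_eval. Qed.

Lemma image_presents :
  presents x (fun t => exists2 c, quad_rel x c & t = quad_tensor c).
Proof.
set rel := fun t => _; split=> [a|t].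
  have [p ->] := pi_surj a; have [t ->] := tensor_eval_X_surj p.
  by exists t; rewrite pi_tensor_eval.
split; last first.
  apply: ideal_gen_morph0 => u [c hc ->].
  by rewrite /= tensor_eval_quad.
(* Membership in the ideal is tested in the algebra [U] presented by the relations. Commutators are
   among them, so the generators of [U] commute, evaluation of tensors in [U] factors through
   polynomials, and each [qform] evaluates to 0. *)
have [u [c _ ->]|U [y ypres]] := @presentation_exists F m rel.
  rewrite tensor_eval_quad big1 // => i _; rewrite big1 // => j _.
  by rewrite mul0r scaler0.
have [ysurj yker] := ypres.
have yrel c : quad_rel x c -> \sum_i \sum_j c i j *: (y i * y j) = 0.
  move=> hc; rewrite -tensor_eval_quad; apply/yker.
  by apply: ideal_gen_base; exists c.
have yC i j : y i * y j = y j * y i.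
  apply/eqP; rewrite -subr_eq0; apply/eqP.
  have := yrel _ (quad_rel_comm pi i j).
  by rewrite -/(mxpair (fun i j => y i * y j) _) linearB /= !mxpair_delta.
have ycentral i u : GRing.comm u (y i).
  have [s ->] := ysurj u; elim/tensor_ind: s => [|a s s' h h'|j s h].
  - by rewrite rmorph1 /GRing.comm mulr1 mul1r.
  - by rewrite linearP /GRing.comm /= mulrDl mulrDr -scalerAl -scalerAr h h'.
  by rewrite rmorphM /= tensor_evalU /GRing.comm -mulrA h !mulrA yC.
pose h (p : S_) : U := mpoly.mmap (in_alg U) y p.
have hcomm (p : S_) al al' : GRing.comm (in_alg U p@_al) (mmap1 y al').
  by rewrite /GRing.comm /= mulr_algl mulr_algr.
have [hM0 h1] := mpoly.commr_mmap_is_multiplicative ycentral hcomm.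
have hM p q : h (p * q) = h p * h q by exact: hM0.
have hX i : h 'X_i = y i by rewrite /h mpoly.mmapX mmap1U.
have hD p q : h (p + q) = h p + h q by exact: mpoly.mmapD.
have h0 : h 0 = 0 by exact: mpoly.mmap0.
have hZ c p : h (c *: p) = c *: h p by rewrite /h (mpoly.mmapZ _ (in_alg U)) /= mulr_algl.
have hT s : h (tensor_eval (fun i => 'X_i : S_) s) = tensor_eval y s.
  elim/tensor_ind: s => [|a s s' e e'|i s e].
  - by rewrite !rmorph1; exact: h1.
  - by rewrite !linearP hD hZ e e'.
  by rewrite !rmorphM /= !tensor_evalU hM e hX.
rewrite -pi_tensor_eval => /pi_ker[c hc]; apply/yker.
rewrite -hT hc (big_morph h hD h0) big1 // => l _.
rewrite hM [X in _ * X](_ : _ = 0) ?mulr0 // -[RHS](yrel _ (quad_rel_C pi_ker l)).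
rewrite /qform (big_morph h hD h0); apply: eq_bigr => i _.
rewrite (big_morph h hD h0); apply: eq_bigr => j _.
by rewrite hZ hM !hX.
Qed.

Theorem image_quadratic : quadratic_algebra image_homog x.
Proof.
split; [exact: image_homog_algebra|exact: image_homog0|exact: image_homog1_basis|].
exact: image_presents.
Qed.
End QuadraticAlgebra.

(** * Functions on the quadric *)

Section CompleteIntersection.
Variables (F : numFieldType) (m r : nat) (C : 'I_r -> 'M[F]_m).
Local Notation S_ := (mpoly.mpoly m F).
Variables (A : comAlgType F) (pi : {lrmorphism S_ -> A}).
Hypothesis pi_surj : forall a, exists p, a = pi p.
Hypothesis pi_ker : forall p, pi p = 0 <-> exists c : 'I_r -> S_, p = \sum_l c l * qform C l.
Variables (a b : 'I_r -> 'I_m) (w : 'I_m -> nat).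
Hypothesis a_neq_b : forall l, a l != b l.
Hypothesis ab_disj : forall l l', l != l' ->
  [/\ a l != a l', a l != b l', b l != a l' & b l != b l'].
Hypothesis C_lead : forall l, C l (a l) (b l) = 1.
Hypothesis lead_qmx : forall l l', qmx C l' (a l) (b l) = (l' == l)%:R.
Hypothesis w_lead : forall l i j, C l i j != 0 -> (i, j) != (a l, b l) ->
  (w i + w j < w (a l) + w (b l))%N.
Hypothesis central_pair : forall l k, exists i j,
  [/\ forall l', qmx C l' i j = (l' == l)%:R, forall l', qmx C l' k i = 0
    & forall l', qmx C l' k j = 0].

Let q l : S_ := \sum_(ij | ij != (a l, b l)) C l ij.1 ij.2 *: ('X_ij.1 * 'X_ij.2).

Lemma qform_lead l : qform C l = 'X_[lead a b l] + q l.
Proof.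
rewrite /qform pair_bigA (bigD1 (a l, b l)) //= C_lead scale1r.
by rewrite /lead mpolyXD.
Qed.

Lemma q_weight l be : be \in msupp (q l) -> (mweigh w be < lead_weight a b w l)%N.
Proof.
rewrite mcoeff_msupp /q big_mkcond mcoeff_sum => /sum_neq0[[i j] /=].
case: ifP => [ij|_]; last by rewrite mcoeff0 eqxx.
rewrite mcoeffZ -mpolyXD mcoeffX mulf_eq0 negb_or pnatr_eq0 eqb0 negbK => /andP[nz /eqP <-].
by rewrite mweighD !mweighU; apply: w_lead.
Qed.

Lemma qform_exact (k : {set 'I_r} -> S_) :
  (forall I, koszul_d (qform C) k I = 0) -> k set0 = 0 ->
  exists k', forall I, k I = koszul_d (qform C) k' I.
Proof.
have -> : qform C = fun l => 'X_[lead a b l] + q l by apply/funext => l; exact: qform_lead.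
exact: (koszul_exact a_neq_b ab_disj q_weight).
Qed.

Theorem complete_intersection_koszul : koszul (image_homog pi).
Proof.
exists m, (fun i => pi 'X_i); split; first exact: image_quadratic pi_surj pi_ker.
exists (qlie (qmx_sym C)), (@odd_base F m r _ (qmx_sym C)); split.
  exact (quadratic_koszul_dual pi_ker lead_qmx central_pair).
exact (quadratic_cohomology (qmx_sym C) (qform_deriv C) (qform_mcoeff0 C) qform_exact pi_surj pi_ker).
Qed.
End CompleteIntersection.

(** * Inequalities for the quadratic weights *)

Lemma double_square_ge t : (4 * t <= 4 * t ^ 2 + 1)%N.
Proof. nia. Qed.
(** With l = s + t, the pairs (2s, 2t) and (2s + 1, 2t - 1) both have sum 2l, so their squares add
    up to 2 l^2 + 2 d^2, where d is s - t in the first case and s - t + 1 in the second. Only s = t,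
    with l even, respectively t = s + 1, with l odd, gives d = 0; that minimum is the left-hand side
    of the four gap lemmas. The square of 2t - 1 is written [4 * t ^ 2 + 1 - 4 * t], where the
    natural subtraction is exact even at t = 0. *)
Lemma even_gap1 s t s0 : (s + t = s0 + s0)%N -> s != s0 -> ((2 * s0) ^ 2 + (2 * s0) ^ 2 < (2 * s) ^ 2 + (2 * t) ^ 2)%N.
Proof. nia. Qed.
Lemma even_gap2 s t s0 : (s + t = s0 + s0)%N -> ((2 * s0) ^ 2 + (2 * s0) ^ 2 < (2 * s + 1) ^ 2 + (4 * t ^ 2 + 1 - 4 * t))%N.
Proof.
move=> h; have hz := double_square_ge t; case: (leqP s0 s) => hs.
  have [d e1] : exists d, s0 = (t + d)%N by exists (s0 - t)%N; lia.
  have e2 : s = (t + d + d)%N by lia.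
  subst. nia.
have [d e1] : exists d, s0 = (s + d)%N by exists (s0 - s)%N; lia.
have e2 : t = (s + d + d)%N by lia.
subst. nia.
Qed.
Lemma odd_gap1 s t s0 : (s + t = s0 + s0.+1)%N -> ((2 * s0 + 1) ^ 2 + (4 * s0.+1 ^ 2 + 1 - 4 * s0.+1) < (2 * s) ^ 2 + (2 * t) ^ 2)%N.
Proof.
move=> h; have hz := double_square_ge s0.+1; case: (leqP s0.+1 s) => hs.
  have [d e1] : exists d, s0 = (t + d)%N by exists (s0 - t)%N; lia.
  have e2 : s = (t + d + d).+1 by lia.
  subst. nia.
have [d e1] : exists d, s0 = (s + d)%N by exists (s0 - s)%N; lia.
have e2 : t = (s + d + d).+1%N by lia.
subst. nia.
Qed.
Lemma odd_gap2 s t s0 : (s + t = s0 + s0.+1)%N -> s != s0 -> ((2 * s0 + 1) ^ 2 + (4 * s0.+1 ^ 2 + 1 - 4 * s0.+1) < (2 * s+1) ^ 2 + (4 * t ^ 2 + 1 - 4 * t))%N.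
Proof. 
move=> h ne; have hz := double_square_ge s0.+1; have hz' := double_square_ge t; case: (leqP s0.+1 s) => hs.
  have [d e1] : exists d, s0 = (t + d)%N by exists (s0 - t)%N; lia.
  have e2 : s = (t + d + d).+1 by lia.
  subst. nia.
have [d e1] : exists d, s0 = (s + d.+1)%N by exists (s0 - s).-1%N; lia.
have e2 : t = (s + d.+1 + d.+1).+1%N by lia.
subst. nia.
Qed.
(** This and the next two bounds keep the subtractions from [K] in [AQ_weight] exact. *)
Lemma even_bound s N : (s <= N)%N -> ((2 * s) ^ 2 <= (2 * N).+1 ^ 2)%N.
Proof. nia. Qed.
Lemma odd_bound s N : (s <= N)%N -> ((2 * s + 1) ^ 2 <= (2 * N).+1 ^ 2)%N.
Proof. nia. Qed.
Lemma shifted_bound s N : (s <= N)%N -> (4 * s ^ 2 + 1 - 4 * s <= (2 * N).+1 ^ 2)%N.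
Proof. nia. Qed.

(** * The quadrics r[l], their leading monomials and weights *)

Section QuadricArcs.
Variables (F : numFieldType) (n N1 N2 : nat).
Local Notation N := (N1 + N2)%N.
Local Notation V := (bool * 'I_n * 'I_N.+1)%type.
Local Notation m := #|AQ_var n N1 N2|.
Local Notation S_ := (mpoly.mpoly m F).
Local Notation r := (N + N).+1.

Definition var_of (p : 'I_m) : V := @enum_val (AQ_var n N1 N2) predT p.
Definition var_rank (v : V) : 'I_m := enum_rank (v : AQ_var n N1 N2).

Lemma var_rankK v : var_of (var_rank v) = v.
Proof. exact: enum_rankK. Qed.

Lemma var_rank_inj : injective var_rank.
Proof. exact: can_inj var_rankK. Qed.

Lemma sum_var_rank (W : nmodType) (f : 'I_m -> W) : \sum_p f p = \sum_v f (var_rank v).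
Proof. exact: (reindex _ (onW_bij _ (@enum_rank_bij (AQ_var n N1 N2)))). Qed.

(** Rows are variables f and columns variables g, not symmetrised: the transpose of the leading
    position would be a second entry of the same weight, against strict maximality. *)
Definition AQ_mx (l : 'I_r) : 'M[F]_m :=
  \matrix_(p, q) [&& ~~ (var_of p).1.1, (var_of q).1.1,
    (var_of p).1.2 == (var_of q).1.2 & ((var_of p).2 + (var_of q).2 == l)%N]%:R.

Lemma AQ_mxE l v v' : AQ_mx l (var_rank v) (var_rank v') =
  [&& ~~ v.1.1, v'.1.1, v.1.2 == v'.1.2 & (v.2 + v'.2 == l)%N]%:R.
Proof. by rewrite mxE !var_rankK. Qed.

Lemma sum_var (W : nmodType) (f : V -> W) : \sum_v f v = \sum_b \sum_i \sum_s f (b, i, s).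
Proof. by rewrite pair_bigA pair_bigA; apply: eq_bigr => -[[b i] s]. Qed.

Lemma AQ_qform (l : 'I_r) : qform AQ_mx l = AQ_r F n N1 N2 (l%:Z - (2 * N1)%N%:Z).
Proof.
rewrite /qform sum_var_rank.
under eq_bigr => v _ do rewrite sum_var_rank.
rewrite sum_var big_bool /= big1 ?add0r => [|i _]; last first.
  rewrite big1 // => s _; rewrite big1 // => v _.
  by rewrite AQ_mxE /= scale0r.
rewrite /AQ_r exchange_big; apply: eq_bigr => s _.
rewrite [RHS]exchange_big; apply: eq_bigr => i _ /=.
rewrite sum_var big_bool /= [X in _ + X]big1 ?addr0 => [|j _]; last first.
  by rewrite big1 // => t _; rewrite AQ_mxE /= scale0r.
rewrite (bigD1 i) //= [X in _ + X]big1 ?addr0 => [|j ji]; last first.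
  by rewrite big1 // => t _; rewrite AQ_mxE /= eq_sym (negPf ji) scale0r.
rewrite [RHS]big_mkcond; apply: eq_bigr => t _.
rewrite AQ_mxE /= eqxx /=.
have -> : (AQ_index s + AQ_index t == l%:Z - (2 * N1)%N%:Z) = (s + t == l)%N.
  by rewrite /AQ_index; lia.
by case: (_ == _); rewrite ?scale1r ?scale0r.
Qed.

Lemma AQ_piE p : AQ_pi F n N1 N2 p = 0 <-> ideal_gen (@AQ_relation F n N1 N2) p.
Proof.
have -> : (0 : AQ F n N1 N2) = AQ_pi F n N1 N2 0 by rewrite rmorph0.
split=> [/eqP|h].
  by rewrite -Quotient.idealrBE subr0 => /asboolP.
by apply/eqP; rewrite -Quotient.idealrBE subr0; apply/asboolP.
Qed.

Lemma AQ_pi_linear : linear (AQ_pi F n N1 N2).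
Proof. by move=> c p q; rewrite rmorphD -mul_mpolyC rmorphM. Qed.

Definition AQ_proj : {lrmorphism S_ -> AQ F n N1 N2} :=
  HB.pack (AQ_pi F n N1 N2 : S_ -> AQ F n N1 N2)
    (GRing.isLinear.Build _ _ _ _ (AQ_pi F n N1 N2 : S_ -> AQ F n N1 N2) AQ_pi_linear)
    (GRing.RMorphism.on (AQ_pi F n N1 N2)).

Lemma AQ_proj_surj a : exists p, a = AQ_proj p.
Proof. by exists (repr a); rewrite [RHS]reprK. Qed.

Lemma AQ_proj_ker p :
  AQ_proj p = 0 <-> exists c : 'I_r -> S_, p = \sum_l c l * qform AQ_mx l.
Proof.
split=> [/AQ_piE|[c ->]]; last first.
  rewrite linear_sum big1 // => l _; apply/AQ_piE; apply: ideal_genMl.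
  apply: ideal_gen_base; exists (l%:Z - (2 * N1)%N%:Z); split; last exact: AQ_qform.
  by have := ltn_ord l; lia.
case=> s [hs ->]; elim: s hs => [|[[u v] u'] s IH] hs.
  by exists (fun=> 0); rewrite big_nil big1 // => l _; rewrite mul0r.
have [|c hc] := IH; first by move=> t ht; apply: hs; rewrite inE ht orbT.
have [l [hl /= ->]] := hs _ (mem_head _ _).
(* The shifted index is nonnegative in the range of the relations, so the absolute value loses
   nothing. *)
have ltl : (absz (l + (2 * N1)%N%:Z)%R < r)%N by lia.
exists (fun l' => c l' + (l' == Ordinal ltl)%:R * (u * u')).
rewrite big_cons hc /=; under [RHS]eq_bigr => l' _ do rewrite mulrDl.
rewrite big_split addrC; congr (_ + _).
rewrite (bigD1 (Ordinal ltl)) //= eqxx mul1r [X in _ = _ + X]big1 ?addr0 => [|l' /negPf ->].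
  rewrite AQ_qform /= mulrAC; congr (_ * _ * _).
  by congr (AQ_r _ _ _ _ _); lia.
by rewrite !mul0r.
Qed.

Hypothesis n2 : (1 < n)%N.
Let i1 : 'I_n := Ordinal (ltnW n2).
Let i2 : 'I_n := Ordinal n2.

Lemma half_le (l : 'I_r) : (l./2 < N.+1)%N.
Proof. by have := ltn_ord l; lia. Qed.

Lemma uphalf_le (l : 'I_r) : (uphalf l < N.+1)%N.
Proof. by have := ltn_ord l; rewrite uphalf_half; lia. Qed.

(** The indices 2c and 2c + 1 have the same half c and would share a variable f; separating them by
    parity makes each of [l./2] and [uphalf l] determine l within its class. *)
Definition lead_index (l : 'I_r) : 'I_n := if odd l then i2 else i1.
Definition lead_f l : 'I_m := var_rank (false, lead_index l, Ordinal (half_le l)).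
Definition lead_g l : 'I_m := var_rank (true, lead_index l, Ordinal (uphalf_le l)).

Lemma half_uphalf l : (l./2 + uphalf l)%N = l.
Proof. by rewrite uphalf_half addnCA addnn odd_double_half. Qed.

Lemma AQ_qmxE l v v' : qmx AQ_mx l (var_rank v) (var_rank v') =
  [&& v.1.1 != v'.1.1, v.1.2 == v'.1.2 & (v.2 + v'.2 == l)%N]%:R.
Proof.
rewrite qmxE !AQ_mxE [v'.1.2 == _]eq_sym [(v'.2 + _)%N]addnC.
by case: v.1.1; case: v'.1.1; rewrite /= ?addr0 ?add0r.
Qed.

Lemma pair_qmx l i l' :
  qmx AQ_mx l' (var_rank (false, i, Ordinal (half_le l)))
    (var_rank (true, i, Ordinal (uphalf_le l))) = (l' == l)%:R.
Proof. by rewrite AQ_qmxE /= eqxx half_uphalf [l' == l]eq_sym -val_eqE. Qed.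

Lemma AQ_central_pair l k : exists i j,
  [/\ forall l', qmx AQ_mx l' i j = (l' == l)%:R, forall l', qmx AQ_mx l' k i = 0
    & forall l', qmx AQ_mx l' k j = 0].
Proof.
have kE : k = var_rank (var_of k) by rewrite /var_rank /var_of enum_valK.
pose i := if (var_of k).1.2 == i1 then i2 else i1.
have hi : ((var_of k).1.2 == i) = false.
  by rewrite /i; case: (eqVneq _ i1) => [->|/negPf].
exists (var_rank (false, i, Ordinal (half_le l))), (var_rank (true, i, Ordinal (uphalf_le l))).
by split=> l'; rewrite ?pair_qmx // kE AQ_qmxE /= hi andbF.
Qed.

Lemma lead_inj l l' : lead_index l = lead_index l' ->
  l./2 = l'./2 \/ uphalf l = uphalf l' -> l = l'.
Proof.
move=> h1 h2; apply: val_inj => /=.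
have : odd l = odd l' by move: h1; rewrite /lead_index; case: (odd l); case: (odd l').
by move: h2; rewrite !uphalf_half; lia.
Qed.

Lemma lead_disj l l' : l != l' ->
  [/\ lead_f l != lead_f l', lead_f l != lead_g l', lead_g l != lead_f l' & lead_g l != lead_g l'].
Proof.
rewrite !(inj_eq var_rank_inj) => nl; split=> //; apply: contra nl => /eqP[h1 h2];
  apply/eqP/lead_inj => //; by [left|right].
Qed.

(* Minus these weights is, up to constants, a quadratic function of the index of the
   variable; its values on f^i[s] and g_i[t] with s + t = l add up to a quadratic function
   of s - t, minimal at s = t for i = i1 and at s + 1 = t for i = i2. *)
Definition AQ_weight (v : V) : nat :=
  let K := ((2 * N).+1 ^ 2)%N in
  (if v.1.2 == i1 then K - (2 * v.2) ^ 2
   else if v.1.2 == i2 then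
     if v.1.1 then K - (4 * v.2 ^ 2 + 1 - 4 * v.2) else K - (2 * v.2 + 1) ^ 2
   else 0)%N.

Lemma AQ_weight_lead l p q : AQ_mx l p q != 0 -> (p, q) != (lead_f l, lead_g l) ->
  (AQ_weight (var_of p) + AQ_weight (var_of q) <
   AQ_weight (var_of (lead_f l)) + AQ_weight (var_of (lead_g l)))%N.
Proof.
have pE : p = var_rank (var_of p) by rewrite /var_rank /var_of enum_valK.
have qE : q = var_rank (var_of q) by rewrite /var_rank /var_of enum_valK.
rewrite pE qE AQ_mxE !var_rankK xpair_eqE !(inj_eq var_rank_inj).
case: (var_of p) => -[b i] s; case: (var_of q) => -[b' i'] t /=.
case: b b' => [] [] /=; rewrite ?eqxx //= pnatr_eq0 eqb0 negbK => /andP[/eqP <- /eqP st].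
have hs : (s <= N)%N by rewrite -ltnS.
have ht : (t <= N)%N by rewrite -ltnS.
have i21 : (i2 == i1) = false by [].
have gap K x y x0 y0 : (x <= K)%N -> (y <= K)%N -> (x0 <= K)%N -> (y0 <= K)%N ->
    (x0 + y0 < x + y)%N -> ((K - x) + (K - y) < (K - x0) + (K - y0))%N.
  lia.
rewrite /AQ_weight /lead_f /lead_g ?var_rankK /= /lead_index ?xpair_eqE /=.
rewrite -[s == _]val_eqE -[t == _]val_eqE /=.
set c := l./2; have hc : (c <= N)%N by rewrite -ltnS half_le.
have [ol|el] := boolP (odd l).
  have e2 : uphalf l = c.+1 by rewrite uphalf_half ol.
  have el : (s + t = c + c.+1)%N by rewrite st -e2 half_uphalf.
  have hc' : (c.+1 <= N)%N by rewrite -e2 -ltnS uphalf_le.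
  rewrite e2 i21 eqxx => ne; case: (eqVneq i i1) => [ei|_].
    apply: gap; rewrite ?even_bound ?odd_bound ?shifted_bound //; exact: odd_gap1.
  (* For any further [i] the weight is 0, and the leading weight is positive because l odd forces c
     < N. *)
  case: (eqVneq i i2) => [ei|_]; last first.
    by move: (odd_bound hc) hc'; nia.
  apply: gap; rewrite ?even_bound ?odd_bound ?shifted_bound //; apply: odd_gap2 => //.
  move: ne; rewrite ei eqxx /=.
  by apply: contraNneq => e; apply/andP; split; apply/eqP; lia.
have e2 : uphalf l = c by rewrite uphalf_half (negPf el).
have sc : (s + t = c + c)%N by rewrite st -{2}e2 half_uphalf.
rewrite e2 eqxx => ne; case: (eqVneq i i1) => [ei|_].
  apply: gap; rewrite ?even_bound ?odd_bound ?shifted_bound //; apply: even_gap1 => //.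
  move: ne; rewrite ei eqxx /=.
  by apply: contraNneq => e; apply/andP; split; apply/eqP; lia.
(* For any further [i] the leading weight is positive because 2c <= 2N < 2N + 1, the square root of
   [K]. *)
case: (eqVneq i i2) => [ei|_]; last by move: hc; nia.
apply: gap; rewrite ?even_bound ?odd_bound ?shifted_bound //; exact: even_gap2.
Qed.

Theorem AQ_koszul : koszul (A := AQ F n N1 N2) (@AQ_homog F n N1 N2).
Proof.
apply: (@complete_intersection_koszul F m r AQ_mx (AQ F n N1 N2) AQ_proj AQ_proj_surj AQ_proj_ker
  lead_f lead_g (fun p => AQ_weight (var_of p))).
- by move=> l; rewrite (inj_eq var_rank_inj).
- exact: lead_disj.
- by move=> l; rewrite AQ_mxE /= eqxx half_uphalf eqxx.
- by move=> l l'; exact: pair_qmx.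
- exact: AQ_weight_lead.
exact: AQ_central_pair.
Qed.
End QuadricArcs.

Theorem theorem11 (R : realType) (n N1 N2 : nat) (hn : (3 <= n)%N) :
  koszul (A := AQ R[i] n N1 N2) (@AQ_homog R[i] n N1 N2).
Proof. by apply: AQ_koszul; apply: leq_trans hn. Qed.
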